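(* Let $n\ge 1$ and let $u:\mathbb{C}^n\to\mathbb{R}$ be a smooth strictly convex function satisfying, for all $x\in\mathbb{C}^n\cong\mathbb{R}^{2n}$, $$\ln\det\partial\bar\partial u(x)=\frac{1}{2}\,x\cdot Du(x)-u(x).$$ Assume the eigenvalues of $\partial\bar\partial u$ are comparable, i.e. there is a constant $\Lambda\ge 1$ such that $\mu_{\max}(x)\le\Lambda\,\mu_{\min}(x)$ for every $x\in\mathbb{C}^n$, where $\mu_{\max}(x)$ and $\mu_{\min}(x)$ are the largest and the smallest eigenvalues of $\partial\bar\partial u(x)$. Then $u$ is quadratic.
   Context: $\mathbb{C}^n$ is identified with $\mathbb{R}^{2n}$ by $z^i=x^i+\sqrt{-1}\,x^{n+i}$, $1\le i\le n$, with $x=(x^1,\dots,x^{2n})$. $Du$ and $D^2u$ are the real gradient and real Hessian of $u$ on $\mathbb{R}^{2n}$, and $x\cdot Du$ is the Euclidean inner product on $\mathbb{R}^{2n}$. $\partial\bar\partial u$ denotes the complex Hessian, i.e. the Hermitian $n\times n$ matrix $\left(\frac{\partial^2u}{\partial z^\alpha\partial\bar z^\beta}\right)$. A smooth function $u$ is strictly convex if its real Hessian $D^2u(x)$ is positive-definite at every point $x$ (in particular $u$ is then pluri-subharmonic and $\partial\bar\partial u$ is positive-definite). ''Quadratic'' means that $u$ is a polynomial of degree at most $2$ in the real coordinates $x^1,\dots,x^{2n}$. *)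

(* Defs.v *)
From HB Require Import structures.
From mathcomp Require Import all_boot all_order all_algebra.
From mathcomp Require Import complex.
From mathcomp Require Import all_classical all_reals all_analysis.
(* The notations of mpoly clash with those of mathcomp-analysis. *)
From mathcomp Require Import -(notations) mpoly.

Set Implicit Arguments.
Unset Strict Implicit.
Unset Printing Implicit Defensive.

Import Order.TTheory GRing.Theory Num.Theory.
Import numFieldNormedType.Exports.

Local Open Scope ring_scope.
Local Open Scope classical_set_scope.
Local Open Scope complex_scope.

Definition partial (R : realType) (m : nat) (k : 'I_m) (f : 'rV[R]_m -> R) :
    'rV[R]_m -> R :=
  fun x => 'D_(delta_mx 0 k) f x.

Definition iter_partial (R : realType) (m : nat) (s : seq 'I_m)
    (f : 'rV[R]_m -> R) : 'rV[R]_m -> R :=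
  foldr (@partial R m) f s.

(* Since 'D_v f x is a total function, the existence of the derivatives has to
   be required separately. *)
Definition smooth (R : realType) (m : nat) (f : 'rV[R]_m -> R) : Prop :=
  forall s : seq 'I_m,
    continuous (iter_partial s f) /\
    forall (k : 'I_m) (x : 'rV[R]_m),
      derivable (iter_partial s f) x (delta_mx 0 k).

Definition gradient (R : realType) (m : nat) (f : 'rV[R]_m -> R)
    (x : 'rV[R]_m) : 'rV[R]_m :=
  \row_k partial k f x.

Definition hessian (R : realType) (m : nat) (f : 'rV[R]_m -> R)
    (x : 'rV[R]_m) : 'M[R]_m :=
  \matrix_(j, k) partial j (partial k f) x.

Definition inner (R : realType) (m : nat) (v w : 'rV[R]_m) : R :=
  \sum_(k < m) v 0 k * w 0 k.

Definition posdef (R : realType) (m : nat) (A : 'M[R]_m) : Prop :=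
  A^T = A /\ forall v : 'rV[R]_m, v != 0 -> 0 < inner (v *m A) v.

Definition strictly_convex (R : realType) (m : nat) (f : 'rV[R]_m -> R) :
    Prop :=
  forall x : 'rV[R]_m, posdef (hessian f x).

(* C^n is represented by 'rV[R]_(n + n): the coordinate x^a of z^a = x^a + i
   x^(n+a) has index [lshift n a], and x^(n+a) has index [rshift n a]. *)

Definition partialC (R : realType) (m : nat) (k : 'I_m)
    (f : 'rV[R]_m -> R[i]) : 'rV[R]_m -> R[i] :=
  fun x => partial k (fun y => complex.Re (f y)) x
           +i* partial k (fun y => complex.Im (f y)) x.

(* The Wirtinger operators d/dz^a and d/d(conj z^a). *)
Definition dz (R : realType) (n : nat) (a : 'I_n)
    (f : 'rV[R]_(n + n) -> R[i]) : 'rV[R]_(n + n) -> R[i] :=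
  fun x => 2^-1 * (partialC (lshift n a) f x - 'i%C * partialC (rshift n a) f x).

Definition dzbar (R : realType) (n : nat) (a : 'I_n)
    (f : 'rV[R]_(n + n) -> R[i]) : 'rV[R]_(n + n) -> R[i] :=
  fun x => 2^-1 * (partialC (lshift n a) f x + 'i%C * partialC (rshift n a) f x).

Definition complex_hessian (R : realType) (n : nat) (u : 'rV[R]_(n + n) -> R)
    (x : 'rV[R]_(n + n)) : 'M[R[i]]_n :=
  \matrix_(a, b) dz a (dzbar b (fun y => (u y)%:C)) x.

(* Only used on Hermitian matrices of size at least 1: all their eigenvalues
   are real, so that the supremum and the infimum below run over a nonempty
   finite set that contains every eigenvalue. *)
Definition real_eigenvalues (R : realType) (n : nat) (A : 'M[R[i]]_n) :
    set R :=
  [set a : R | eigenvalue A a%:C].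

Definition mu_max (R : realType) (n : nat) (A : 'M[R[i]]_n) : R :=
  sup (real_eigenvalues A).

Definition mu_min (R : realType) (n : nat) (A : 'M[R[i]]_n) : R :=
  inf (real_eigenvalues A).

(* [msize p] is the total degree of p plus one (and 0 for p = 0). *)
Definition quadratic (R : realType) (m : nat) (f : 'rV[R]_m -> R) : Prop :=
  exists p : mpoly m R,
    (msize p <= 3)%N /\
    forall x : 'rV[R]_m, f x = meval (fun k => x 0 k) p.

(* Main.v *)
Require Import Defs.
From HB Require Import structures.
From mathcomp Require Import all_boot all_order all_algebra.
From mathcomp Require Import complex ring lra.
From mathcomp Require Import all_classical all_reals all_analysis.
From mathcomp Require Import -(notations) mpoly.

Set Implicit Arguments.
Unset Strict Implicit.
Unset Printing Implicit Defensive.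

Import Order.TTheory GRing.Theory Num.Theory.
Import numFieldNormedType.Exports.

Local Open Scope ring_scope.
Local Open Scope classical_set_scope.

(* Let G be the complex Hessian of u and phi = x.Du/2 - u = ln det G.  Since
   ln det is concave on positive Hermitian matrices, comparing it with its
   tangent at G(x) and moving radially from x shows L phi = 0, where
   L f = tr (G^-1 . complex Hessian of f) - x.Df/2.
   As the eigenvalues of G are comparable and their product is exp phi, each is
   within a factor Lambda of exp (phi/n); hence L is controlled by exp (-phi/n).

   On the ball |x|^2 < r the function phi + n ln (r - |x|^2) has an interior
   maximum, where the maximum principle gives
   |x|^2 exp (phi/n) (r - |x|^2) <= C r.  Letting r go to infinity, phi is
   bounded and attains its maximum.  If phi were smaller somewhere, at y, then
   phi + eps exp (- alpha |x - y|^2) would attain its maximum at some point away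
   from y, where L of the perturbation is positive for large alpha: a
   contradiction.  So phi is constant, hence the second derivatives of u are
   homogeneous of degree 0 and smooth at the origin, i.e. constant. *)

(** * Directional derivatives *)

Section DirectionalDerivatives.
Context {R : realType} {V : normedModType R}.
Implicit Types (f : V -> R) (x v w : V).

Lemma is_derive_line f x v (t : R) (l : R) :
  is_derive (x + t *: v) v f l ->
  is_derive t 1 (fun s : R => f (x + s *: v)) l.
Proof.
move=> [df <-].
have E : (fun h : R => h^-1 *: (((fun s : R => f (x + s *: v)) \o shift t) (h *: 1)
     - f (x + t *: v))) =
   (fun h => h^-1 *: ((f \o shift (x + t *: v)) (h *: v) - f (x + t *: v))).
  apply/funext => h /=; rewrite [h *: 1]mulr1 scalerDl; congr (_ *: (f _ - _)).
  by rewrite addrCA.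
by split; rewrite /derivable /derive E.
Qed.

Lemma MVT_line f (g : V -> R) x v (h : R) :
  (forall s : R, is_derive (x + s *: v) v f (g (x + s *: v))) ->
  exists2 xi : R, `|xi| <= `|h| & f (x + h *: v) - f x = h * g (x + xi *: v).
Proof.
move=> df.
have dl (s : R) : is_derive s 1 (fun s : R => f (x + s *: v)) (g (x + s *: v)).
  exact: is_derive_line.
have cl (i : interval R) : {within [set` i], continuous (fun s : R => f (x + s *: v))}.
  by apply: derivable_within_continuous => s _; case: (dl s).
have [h0|h0] := leP 0 h.
  have [xi] := MVT_segment h0 (fun s _ => dl s) (cl _).
  rewrite in_itv /= scale0r addr0 subr0 => /andP[x0 xh] ->.
  by exists xi; rewrite 1?mulrC// !ger0_norm.
have [xi] := MVT_segment (ltW h0) (fun s _ => dl s) (cl _).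
rewrite in_itv /= scale0r addr0 sub0r => /andP[x0 xh] /eqP.
rewrite -eqr_opp opprB => /eqP ->.
by exists xi; rewrite ?ler0_norm ?lerN2 ?(ltW h0)//; ring.
Qed.

Lemma continuous_shift2 f x v w :
  {for x, continuous f} -> forall e : R, 0 < e ->
  exists2 d : R, 0 < d & forall s t : R, `|s| <= d -> `|t| <= d ->
    `|f (x + s *: v + t *: w) - f x| < e.
Proof.
move=> cf e e0.
have /cvgrPdist_lt/(_ e e0) := cf.
rewrite near_simpl => /nbhs_ballP[r /= r0 rP].
(* The added 1 keeps the denominator positive when [v] and [w] both vanish. *)
exists (r / (2 * (`|v| + `|w| + 1))).
  by rewrite divr_gt0// mulr_gt0// ltr_wpDl// addr_ge0.
move=> s t sd td; rewrite distrC; apply: rP.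
rewrite -ball_normE /= opprD addrA opprD addrA subrr add0r.
rewrite -opprD normrN (le_lt_trans (ler_normD _ _))// !normrZ.
set K := r / _ in sd td.
have N0 : 0 < `|v| + `|w| + 1 by rewrite ltr_wpDl// addr_ge0.
have K0 : 0 < K by rewrite divr_gt0// mulr_gt0.
have KE : K * (2 * (`|v| + `|w| + 1)) = r by rewrite divfK// lt0r_neq0// mulr_gt0.
have A1 := ler_wpM2r (normr_ge0 v) sd.
have A2 := ler_wpM2r (normr_ge0 w) td.
rewrite -KE (le_lt_trans (lerD A1 A2))// -mulrDr ltr_pM2l//.
by have := normr_ge0 v; have := normr_ge0 w; lra.
Qed.

(** The increment along [v + w] splits into one along [v] from [x] and one along [w] from [x + h v].
    The mean value theorem turns the second quotient into ['D_w f] at a nearby point, and continuity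
    gives its limit. *)
Lemma is_deriveDdir f x v w l : derivable f x v ->
  (forall y, derivable f y w) -> {for x, continuous ('D_w f)} ->
  'D_v f x + 'D_w f x = l -> is_derive x (v + w) f l.
Proof.
move=> dv dw cw <-.
pose q h := h^-1 *: ((f \o shift x) (h *: (v + w)) - f x).
suff L : q @ 0^' --> 'D_v f x + 'D_w f x.
  by split; [apply/cvg_ex; exists ('D_v f x + 'D_w f x) | exact/cvg_lim].
have -> : q = (fun h => h^-1 *: ((f \o shift x) (h *: v) - f x) +
    h^-1 *: (f (x + h *: v + h *: w) - f (x + h *: v))).
  apply/funext => h; rewrite /q /= -scalerDr; congr (_ *: _).
  by rewrite scalerDr addrC [h *: v + _ + x]addrC addrA [h *: v + x]addrC; ring.
apply: cvgD; first exact: dv.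
apply/cvgrPdist_lt => e e0; have [d d0 dP] := continuous_shift2 v w cw e0.
near=> h; have [xi xih ->] := @MVT_line f ('D_w f) (x + h *: v) w h
  (fun s => derivableP (dw _)).
rewrite -[_ *: (h * _)]/(_ * (h * _)) mulrA mulVf ?mul1r.
  by rewrite distrC; apply: dP; last apply: (le_trans xih); near: h;
    apply: dnbhs0_le.
by near: h; exact: nbhs_dnbhs_neq.
Unshelve. all: by end_near.
Qed.

Lemma is_deriveZdir f x v (k : R) l l' :
  is_derive x v f l' -> k * l' = l -> is_derive x (k *: v) f l.
Proof.
move=> [dv <-] <-; have [->|k0] := eqVneq k 0.
  by rewrite scale0r mul0r; exact: is_derive0.
have D : is_derive (0 : R) 1 (fun s : R => f (x + s *: v)) ('D_v f x).
  by apply: is_derive_line; rewrite scale0r addr0; exact: derivableP.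
have D0 : is_derive (0 : R) 1 (k \*: id : R -> R) (k *: 1) by exact: is_deriveZ.
have [D3 D4] : is_derive (0 : R) 1 ((fun s : R => f (x + s *: v)) \o (k \*: id))
    (k * 'D_v f x).
  apply: is_derive_eq; first by apply: is_derive1_comp; rewrite /= scaler0; exact: D.
  by rewrite [k *: 1]mulr1 mulrC.
have E : (fun h : R => h^-1 *: ((((fun s : R => f (x + s *: v)) \o (k \*: id)) \o shift 0) (h *: 1)
     - f (x + (k * 0) *: v))) =
   (fun h => h^-1 *: ((f \o shift x) (h *: (k *: v)) - f x)).
  apply/funext => h /=; rewrite [h *: 1]mulr1 addr0 mulr0 scale0r addr0.
  by rewrite [h *: _ + x]addrC scalerA [h * k]mulrC.
by split; [move: D3 | move: D4]; rewrite /derivable /derive /= E.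
Qed.

(* Both sides are the limit of the double difference quotient
   [(f (x + hv + hw) - f (x + hv) - f (x + hw) + f x) / h^2]. *)
Lemma derive_comm f x v w :
  (forall y, derivable f y v) -> (forall y, derivable f y w) ->
  (forall y, derivable ('D_v f) y w) -> (forall y, derivable ('D_w f) y v) ->
  {for x, continuous ('D_w ('D_v f))} -> {for x, continuous ('D_v ('D_w f))} ->
  'D_w ('D_v f) x = 'D_v ('D_w f) x.
Proof.
(* The mean value theorem is used twice: along [v'] for the difference [F], then along [w'] for the
   derivative of [f] along [v']. *)
have key v' w' (h : R) : (forall y, derivable f y v') ->
    (forall y, derivable ('D_v' f) y w') ->
    exists s t : R, [/\ `|s| <= `|h|, `|t| <= `|h| &
      f (x + h *: v' + h *: w') - f (x + h *: v') - (f (x + h *: w') - f x) =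
      h * (h * 'D_w' ('D_v' f) (x + s *: v' + t *: w'))].
  move=> dv dvw.
  pose F y := f (y + h *: w') - f y.
  have dF (s : R) : is_derive (x + s *: v') v' F
      ('D_v' f (x + s *: v' + h *: w') - 'D_v' f (x + s *: v')).
    apply: is_deriveB; last exact: derivableP.
    have [d1 d2] := derivableP (dv (x + s *: v' + h *: w')).
    have E' : (fun h0 : R => h0^-1 *: (((fun y => f (y + h *: w')) \o shift (x + s *: v')) (h0 *: v') - f (x + s *: v' + h *: w'))) =
      (fun h0 => h0^-1 *: ((f \o shift (x + s *: v' + h *: w')) (h0 *: v') - f (x + s *: v' + h *: w'))).
      by apply/funext => h0 /=; rewrite -[h0 *: v' + _ + h *: w']addrA.
    by split; rewrite /derivable /derive /= E'.
  have [s sh] := @MVT_line F (fun y => 'D_v' f (y + h *: w') - 'D_v' f y) x v' h dF.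
  have [t th ->] := @MVT_line ('D_v' f) ('D_w' ('D_v' f)) (x + s *: v') w' h
    (fun s => derivableP (dvw _)).
  by rewrite /F => FE; exists s, t; split => //; rewrite -FE; ring.
move=> dv dw dvw dwv c1 c2; apply/eqP; rewrite -subr_eq0 -normr_le0.
apply/ler_addgt0Pl => e e0; rewrite addr0.
have e20 : 0 < e / 2 by rewrite divr_gt0.
have [d1 d10 P1] := continuous_shift2 v w c1 e20.
have [d2 d20 P2] := continuous_shift2 w v c2 e20.
pose h := Num.min d1 d2.
have h0 : 0 < h by rewrite lt_min d10.
have hd1 : `|h| <= d1 by rewrite gtr0_norm// ge_min lexx.
have hd2 : `|h| <= d2 by rewrite gtr0_norm// ge_min lexx orbT.
have [s1 [t1 [s1h t1h E1]]] := key v w h dv dvw.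
have [s2 [t2 [s2h t2h E2]]] := key w v h dw dwv.
have E : 'D_w ('D_v f) (x + s1 *: v + t1 *: w) = 'D_v ('D_w f) (x + s2 *: w + t2 *: v).
  apply: (mulfI (lt0r_neq0 h0)); apply: (mulfI (lt0r_neq0 h0)).
  apply: etrans (esym E1) (etrans _ E2); rewrite (addrAC x).
  by rewrite !opprB addrACA [RHS]addrACA; congr (_ + _); rewrite addrC.
have Q1 := P1 s1 t1 (le_trans s1h hd1) (le_trans t1h hd1).
have Q2 := P2 s2 t2 (le_trans s2h hd2) (le_trans t2h hd2).
apply: le_trans (ler_distD _ _ _) _; rewrite [e]splitr.
by apply: lerD; apply: ltW; [rewrite distrC; exact: Q1 | rewrite E; exact: Q2].
Qed.

End DirectionalDerivatives.

(** If [l] were positive, [F1], which vanishes at 0, would be positive just to the right of 0, and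
    the mean value theorem would make [F b] larger than [F 0]. *)
Lemma is_derive_le0_at_max (R : realType) (F F1 : R -> R) (e l : R) : 0 < e ->
  (forall t : R, `|t| < e -> is_derive t 1 F (F1 t)) ->
  is_derive (0 : R) 1 F1 l ->
  (forall t : R, `|t| < e -> F t <= F 0) -> F1 0 = 0 /\ l <= 0.
Proof.
move=> e0 dF dF1 Fmax.
have abs_itv t : t \in `](- e), e[%R -> `|t| < e.
  by rewrite in_itv /= ltr_norml.
have F10 : F1 0 = 0.
  have ne : - e <= e by rewrite ge0_cp ?ltW.
  have i0 : 0 \in `](- e), e[%R by rewrite in_itv /= oppr_lt0 e0.
  have [_ D0] : is_derive (0 : R) 1 F 0.
    apply: (derive1_at_max ne) => // t /abs_itv te; last exact: Fmax.
    by case: (dF t te).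
  have d0 : is_derive (0 : R) 1 F (F1 0) by apply: dF; rewrite normr0.
  by have [_ <-] := d0.
split=> //; rewrite leNgt; apply/negP => l0.
have [dF1' El] := dF1.
have : \forall h \near (0 : R)^', 0 < h^-1 * F1 h.
  have : (fun h => h^-1 * F1 h) @ (0 : R)^' --> l.
    rewrite -El /derive.
    have -> : (fun h => h^-1 * F1 h) = (fun h => h^-1 *: ((F1 \o shift 0) (h *: 1) - F1 0)).
      by apply/funext => h /=; rewrite F10 subr0 addr0 [h *: 1]mulr1.
    exact: dF1'.
  by move=> /cvgrPdist_lt/(_ l l0); apply: filterS => h; rewrite ltr_norml; lra.
rewrite /dnbhs /within /= nbhsE /= => -[U [oU U0] UP].
have /nbhs_ballP[r /= r0 rP] := open_nbhs_nbhs (conj oU U0).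
pose b := Num.min (r / 2) (e / 2).
have b0 : 0 < b by rewrite lt_min !divr_gt0.
have br : b < r by rewrite gt_min ltr_pdivrMr// ltr_pMr// ltr1n.
have be : b < e by rewrite gt_min orbC ltr_pdivrMr// ltr_pMr// ltr1n.
have ine t : 0 <= t -> t <= b -> `|t| < e.
  by move=> t0 tb; rewrite ger0_norm// (le_lt_trans tb).
have cF : {within `[0, b], continuous F}.
  apply: derivable_within_continuous => t; rewrite in_itv /= => /andP[t0 tb].
  by have [] := dF t (ine _ t0 tb).
have [|c] := @MVT R F F1 0 b b0 _ cF.
  by move=> t; rewrite in_itv /= => /andP[/ltW t0 /ltW tb]; exact/dF/ine.
rewrite in_itv /= subr0 => /andP[c0 cb] E.
have Fb := Fmax b (ine _ (ltW b0) (lexx _)).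
have : 0 < c^-1 * F1 c.
  apply: UP; last by rewrite gt_eqF.
  by apply: rP; rewrite /ball /= sub0r normrN gtr0_norm// (lt_trans cb).
rewrite pmulr_rgt0 ?invr_gt0// => Fc.
by have := mulr_gt0 Fc b0; rewrite -E subr_gt0 ltNge Fb.
Qed.

(** * Smooth functions and the phase *)

Section SmoothFunctions.
Context {R : realType} {m : nat}.
Local Notation E := ('rV[R]_m).
Implicit Types (f g : E -> R) (x y v w : E).

Lemma innerE v w : inner v w = (v *m w^T) 0 0.
Proof. by rewrite mxE; apply: eq_bigr => k _; rewrite mxE. Qed.

Lemma innerC v w : inner v w = inner w v.
Proof. by apply: eq_bigr => k _; rewrite mulrC. Qed.

Lemma innerDl v v' w : inner (v + v') w = inner v w + inner v' w.
Proof. by rewrite !innerE mulmxDl mxE. Qed.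

Lemma innerDr v w w' : inner v (w + w') = inner v w + inner v w'.
Proof. by rewrite !(innerC v) innerDl. Qed.

Lemma innerZl (a : R) v w : inner (a *: v) w = a * inner v w.
Proof. by rewrite !innerE -scalemxAl mxE. Qed.

Lemma innerZr (a : R) v w : inner v (a *: w) = a * inner v w.
Proof. by rewrite !(innerC v) innerZl. Qed.

Lemma inner_ge0 v : 0 <= inner v v.
Proof. by apply: sumr_ge0 => k _; rewrite -expr2 sqr_ge0. Qed.

Lemma inner_delta (a : 'I_m) w : inner (delta_mx 0 a) w = w 0 a.
Proof. by rewrite innerE -rowE !mxE. Qed.

(** Parseval at each coordinate vector gives 1; summing over the coordinates collects all squared
    entries of the [e i]. *)
Lemma parseval_trace (p : nat) (e : 'I_p -> E) :
  (forall w, \sum_i inner w (e i) ^+ 2 = inner w w) ->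
  \sum_i inner (e i) (e i) = m%:R.
Proof.
move=> pars; rewrite exchange_big /=.
rewrite -[X in X%:R]card_ord -sumr_const; apply: eq_bigr => a _.
apply: (@etrans _ _ (inner (delta_mx 0 a) (delta_mx 0 a))); last first.
  by rewrite inner_delta mxE !eqxx.
by rewrite -pars; apply: eq_bigr => i _; rewrite inner_delta expr2.
Qed.

Lemma smooth_continuous f : smooth f -> continuous f.
Proof. by move=> sf; have [] := sf [::]. Qed.

Lemma smooth_partial (k : 'I_m) f : smooth f -> smooth (partial k f).
Proof.
move=> sf s; have := sf (rcons s k).
by rewrite /iter_partial -cats1 foldr_cat.
Qed.

Lemma is_derive_partial (k : 'I_m) f x : smooth f ->
  is_derive x (delta_mx 0 k) f (partial k f x).
Proof. by move=> sf; apply: derivableP; have [_ /(_ k x)] := sf [::]. Qed.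

(** [smooth] speaks of coordinate directions only; a general direction is reached by adding
    coordinates one at a time with [is_deriveDdir]. *)
Lemma is_derive_smooth f x v : smooth f ->
  is_derive x v f (inner v (gradient f x)).
Proof.
move=> sf.
have -> : inner v (gradient f x) = \sum_(k < m) v 0 k * partial k f x.
  by apply: eq_bigr => k _; rewrite mxE.
rewrite [v in is_derive _ v](row_sum_delta v).
elim: (index_enum _) => [|k s IHs]; first by rewrite !big_nil; exact: is_derive0.
(* The single coordinate direction goes second, where [is_deriveDdir] asks for a derivative that
   exists everywhere and is continuous; the induction hypothesis concerns the point [x] alone. *)
rewrite !big_cons [X in is_derive _ X]addrC [X in is_derive _ _ _ X]addrC.
have dk y : is_derive y (v 0 k *: delta_mx 0 k) f (v 0 k * partial k f y).
  by apply: is_deriveZdir; first exact: is_derive_partial.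
have Dk : 'D_(v 0 k *: delta_mx 0 k) f = (fun y => v 0 k * partial k f y).
  by apply/funext => y; have [_] := dk y.
apply: is_deriveDdir.
- by case: IHs.
- by move=> y; case: (dk y).
- by rewrite Dk; apply: continuousM; [exact: cst_continuous|exact/smooth_continuous/smooth_partial].
- by case: (dk x) => _ ->; case: IHs => _ ->.
Qed.

Lemma deriveE_smooth f v x : smooth f -> 'D_v f x = inner v (gradient f x).
Proof. by move=> sf; have [] := is_derive_smooth x v sf. Qed.

Lemma iter_partial_lincomb (I : Type) (r : seq I) (c : I -> R) (F : I -> E -> R)
    (s : seq 'I_m) : (forall i, smooth (F i)) ->
  iter_partial s (fun x => \sum_(i <- r) c i * F i x) =
    (fun x => \sum_(i <- r) c i * iter_partial s (F i) x) /\
  forall x k, is_derive x (delta_mx 0 k)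
    (fun x => \sum_(i <- r) c i * iter_partial s (F i) x)
    (\sum_(i <- r) c i * iter_partial (k :: s) (F i) x).
Proof.
move=> sF.
have dF s' x k : is_derive x (delta_mx 0 k)
    (fun x => \sum_(i <- r) c i * iter_partial s' (F i) x)
    (\sum_(i <- r) c i * iter_partial (k :: s') (F i) x).
  elim: r => [|i r IHr].
    by under eq_fun do rewrite big_nil; rewrite big_nil; exact: is_derive_cst.
  under eq_fun do rewrite big_cons; rewrite big_cons.
  apply: is_deriveD; apply: is_deriveZ; apply: derivableP.
  by have [_ /(_ k x)] := sF i s'.
split; last exact: dF.
elim: s => [//|k s IHs]; rewrite [LHS]/= -/(iter_partial _ _) IHs.
by apply/funext => x; have [_] := dF s x k.
Qed.

Lemma smooth_lincomb (I : Type) (r : seq I) (c : I -> R) (F : I -> E -> R) :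
  (forall i, smooth (F i)) -> smooth (fun x => \sum_(i <- r) c i * F i x).
Proof.
move=> sF s; have [-> d] := iter_partial_lincomb r c s sF.
split=> [x|k x]; last by case: (d x k).
elim: r {d} => [|i r IHr].
  by under eq_fun do rewrite big_nil; exact: cst_continuous.
under eq_fun do rewrite big_cons.
have cM : {for x, continuous (fun y => c i * iter_partial s (F i) y)}.
  by apply: continuousM; [exact: cst_continuous|exact: (sF i s).1].
exact: (continuousD cM IHr).
Qed.

Lemma smooth_derive f v : smooth f -> smooth ('D_v f).
Proof.
move=> sf.
have -> : 'D_v f = fun x => \sum_(k < m) v 0 k * partial k f x.
  apply/funext => x; rewrite (deriveE_smooth v x sf).
  by apply: eq_bigr => k _; rewrite mxE.
by apply: smooth_lincomb => k; exact: smooth_partial.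
Qed.

Lemma smooth_derivable f x v : smooth f -> derivable f x v.
Proof. by move=> sf; case: (is_derive_smooth x v sf). Qed.

Lemma smooth_derive_comm f v w x : smooth f ->
  'D_w ('D_v f) x = 'D_v ('D_w f) x.
Proof.
move=> sf; have [sv sw] := (smooth_derive v sf, smooth_derive w sf).
apply: derive_comm => [y|y|y|y||].
- exact: smooth_derivable sf.
- exact: smooth_derivable sf.
- exact: smooth_derivable sv.
- exact: smooth_derivable sw.
- exact: smooth_continuous (smooth_derive w sv) x.
- exact: smooth_continuous (smooth_derive v sw) x.
Qed.

Lemma derive2_hessian f x v : smooth f ->
  'D_v ('D_v f) x = inner (v *m hessian f x) v.
Proof.
move=> sf; rewrite (deriveE_smooth v x (smooth_derive v sf)).
rewrite innerC; apply: eq_bigr => k _; congr (_ * _).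
rewrite mxE /partial (smooth_derive_comm v (delta_mx 0 k) x sf) -/(partial k f).
rewrite (deriveE_smooth v x (smooth_partial k sf)).
rewrite mxE; apply: eq_bigr => j _; rewrite !mxE; congr (_ * _).
Qed.

(** The Euler operator x.D, which multiplies a homogeneous function by its degree. *)
Definition euler f x : R := inner x (gradient f x).

Lemma euler_derive f x : smooth f -> euler f x = 'D_x f x.
Proof. by move=> sf; rewrite (deriveE_smooth x x sf). Qed.

Lemma is_derive_coord x v (k : 'I_m) : is_derive x v (fun y : E => y 0 k) (v 0 k).
Proof.
suff L : (fun h => h^-1 *: (((fun y : E => y 0 k) \o shift x) (h *: v) - x 0 k)) @ 0^'
    --> v 0 k.
  by split; [apply/cvg_ex; exists (v 0 k) | exact/cvg_lim].
apply: cvg_near_cst; near=> h.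
have h0 : h != 0 by near: h; exact: nbhs_dnbhs_neq.
by rewrite /= !mxE addrK -[_ *: _]/(_ * _) mulrA mulVf// mul1r.
Unshelve. all: by end_near.
Qed.

(** The commutator of ['D_v] with the Euler operator is ['D_v], because differentiating the
    coefficient [y 0 k] leaves [v 0 k]. *)
Lemma is_derive_euler f x v : smooth f ->
  is_derive x v (euler f) (euler ('D_v f) x + 'D_v f x).
Proof.
move=> sf.
have -> : euler f = fun y => \sum_(k < m) y 0 k * partial k f y.
  by apply/funext => y; apply: eq_bigr => k _; rewrite mxE.
have -> : euler ('D_v f) x + 'D_v f x =
    \sum_(k < m) (x 0 k * 'D_v (partial k f) x + partial k f x * v 0 k).
  rewrite big_split /=; congr (_ + _).
    have pk k : partial k ('D_v f) x = 'D_v (partial k f) x.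
      exact: smooth_derive_comm.
    by apply: eq_bigr => k _; rewrite mxE pk.
  rewrite (deriveE_smooth v x sf); apply: eq_bigr => k _.
  by rewrite mxE mulrC.
have dk k : is_derive x v (fun y => y 0 k * partial k f y)
    (x 0 k * 'D_v (partial k f) x + partial k f x * v 0 k).
  apply: is_deriveM; first exact: is_derive_coord.
  exact/derivableP/smooth_derivable/smooth_partial.
have -> : (fun y : E => \sum_(k < m) y 0 k * partial k f y) =
    \sum_(k < m) (fun y : E => y 0 k * partial k f y).
  by apply/funext => y; rewrite fct_sumE.
exact: is_derive_sum.
Qed.

(** * Euclidean balls: compactness, neighbourhoods and maxima *)

Lemma continuous_dist2 x : continuous (fun y : E => inner (y - x) (y - x)).
Proof.
have -> : (fun y : E => inner (y - x) (y - x)) =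
    \sum_(k < m) (fun y : E => (y - x) 0 k * (y - x) 0 k).
  by apply/funext => y; rewrite fct_sumE.
move=> y; apply: (big_ind (fun f => {for y, continuous f})).
- exact: cst_continuous.
- by move=> f g; exact: continuousD.
move=> k _; have ck : {for y, continuous (fun y : E => (y - x) 0 k)}.
  have -> : (fun y : E => (y - x) 0 k) = fun y => y 0 k - x 0 k.
    by apply/funext => z; rewrite !mxE.
  by apply: continuousB; [exact: coord_continuous|exact: cst_continuous].
exact: continuousM.
Qed.

(** The norm of ['rV[R]_m] is the sup norm, so Euclidean balls are written with [inner] and compared
    with it coordinate by coordinate. *)
Lemma euclidean_ball_compact x (r : R) :
  compact [set y : E | inner (y - x) (y - x) <= r].
Proof.
apply: bounded_closed_compact; last first.
  apply: (@closed_comp _ _ (fun y => inner (y - x) (y - x)) [set t : R | t <= r]).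
    by move=> y _; exact: continuous_dist2.
  exact: closed_le.
(* A real t with t^2 <= r satisfies |t| <= 1 + r, which avoids a square root. *)
exists (1 + r + `|x|); split; first exact: num_real.
move=> M rM y /= yr; rewrite -[y](subrK x) (le_trans (ler_normD _ _))//.
rewrite -lerBrDr; have rx : 1 + r < M - `|x| by rewrite ltrBrDr.
apply: le_trans (ltW rx).
have r0 : 0 <= r := le_trans (inner_ge0 _) yr.
rewrite [leLHS]/Num.norm /= mx_normrE; apply: bigmax_le; first lra.
move=> [i k] _ /=; rewrite ord1.
have : ((y - x) 0 k) ^+ 2 <= r.
  apply: le_trans yr; rewrite [leRHS](bigD1 k)//= -expr2 lerDl.
  by apply: sumr_ge0 => j _; rewrite -expr2 sqr_ge0.
by rewrite -real_normK ?num_real//; nra.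
Qed.

Lemma euclidean_ball_nbhs (y : E) (A : set E) : nbhs y A ->
  exists2 r : R, 0 < r & forall x : E, inner (x - y) (x - y) <= r -> A x.
Proof.
move=> /nbhs_ballP[e /= e0 eA]; exists ((e / 2) ^+ 2); first by rewrite exprn_gt0// divr_gt0.
move=> x xr; apply: eA; rewrite -ball_normE /= distrC.
apply: (@le_lt_trans _ _ (e / 2)); last by rewrite ltr_pdivrMr// ltr_pMr// ltr1n.
rewrite [leLHS]/Num.norm /= mx_normrE; apply: bigmax_le; first by rewrite divr_ge0// ltW.
move=> [i j] _ /=; rewrite ord1.
rewrite -(@ler_pXn2r _ 2) ?nnegrE ?normr_ge0 ?divr_ge0 ?(ltW e0)//.
rewrite real_normK ?num_real//; apply: (le_trans _ xr).
rewrite [leRHS](bigD1 j)//= -expr2 lerDl.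
by apply: sumr_ge0 => l _; rewrite -expr2 sqr_ge0.
Qed.

Lemma max_closed_ball f x (r : R) : 0 <= r -> continuous f ->
  exists2 z, inner (z - x) (z - x) <= r &
    forall y, inner (y - x) (y - x) <= r -> f y <= f z.
Proof.
move=> r0 cf; have [||z] := EVT_max_rV _ (@euclidean_ball_compact x r) _ (f := f).
- by exists x; rewrite /= subrr innerE mul0mx mxE.
- exact: continuous_subspaceT.
rewrite inE /= => zr zmax; exists z => // y yr; apply: zmax.
by rewrite inE.
Qed.


(** * The phase phi, its derivatives and its linearized equation *)

Definition phase f x : R := 2^-1 * euler f x - f x.

Lemma phase_continuous f : smooth f -> continuous (phase f).
Proof.
move=> sf x; have -> : phase f = (2^-1 \*: euler f) - f by [].
apply: continuousB; last exact: smooth_continuous.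
apply: continuousZl_tmp.
have -> : euler f = \sum_(k < m) (fun y : E => y 0 k * partial k f y).
  apply/funext => y; rewrite fct_sumE; apply: eq_bigr => k _.
  by rewrite mxE.
apply: (big_ind (fun f => {for x, continuous f})).
- exact: cst_continuous.
- by move=> g h; exact: continuousD.
move=> k _; apply: continuousM; first exact: coord_continuous.
exact/smooth_continuous/smooth_partial.
Qed.

Lemma is_derive_phase f x v : smooth f ->
  is_derive x v (phase f) (2^-1 * (euler ('D_v f) x - 'D_v f x)).
Proof.
move=> sf.
have de := is_derive_euler x v sf.
have df := derivableP (@smooth_derivable _ x v sf).
have -> : phase f = (2^-1 \*: euler f) - f by [].
apply: is_derive_eq.
by rewrite -[_ *: _]/(_ * _); field.
Qed.

(** When the commutator is applied a second time the first-order terms cancel. This lets the radial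
    derivative of a second derivative of [f] be traded for a second derivative of the phase. *)
Lemma is_derive2_phase f x v : smooth f ->
  is_derive x v ('D_v (phase f)) (2^-1 * 'D_x ('D_v ('D_v f)) x).
Proof.
move=> sf; have sv := smooth_derive v sf.
have -> : 'D_v (phase f) = (2^-1 \*: euler ('D_v f)) - (2^-1 \*: 'D_v f).
  apply/funext => y; have [_ ->] := is_derive_phase y v sf.
  by rewrite mulrBr.
have de := is_derive_euler x v sv.
have df := derivableP (@smooth_derivable _ x v sv).
apply: is_derive_eq.
rewrite -(euler_derive x (smooth_derive v sv)).
by rewrite -![_ *: _]/(_ * _); ring.
Qed.

(* The hypothesis [touch] says that the concave function log det lies below its
   tangent hyperplane at the Hessian of [f] at [x]; differentiating along [x],
   it yields the linearized equation [L phi = x . D phi / 2]. *)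
Lemma phase_linearized (p : nat) (c : 'I_p -> R) (v : 'I_p -> E) f x :
  smooth f ->
  (forall y, phase f y - phase f x <= \sum_i c i *
     ('D_(v i) ('D_(v i) f) y - 'D_(v i) ('D_(v i) f) x)) ->
  'D_x (phase f) x = 2 * \sum_i c i * 'D_(v i) ('D_(v i) (phase f)) x.
Proof.
move=> sf touch.
have s2 i : smooth ('D_(v i) ('D_(v i) f)) by exact/smooth_derive/smooth_derive.
pose S y := \sum_i c i * 'D_(v i) ('D_(v i) f) y.
have sS : smooth S by exact: smooth_lincomb.
have dS : 'D_x S x = \sum_i c i * 'D_x ('D_(v i) ('D_(v i) f)) x.
  have -> : S = \sum_i (c i \*: 'D_(v i) ('D_(v i) f)).
    by apply/funext => y; rewrite fct_sumE.
  apply: derive_val; apply: is_derive_sum => i; apply: is_deriveZ.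
  exact: derivableP (smooth_derivable (s2 i)).
have cross (a b a' b' : R) : a - b <= a' - b' -> a - a' <= b - b' by lra.
have dP y : is_derive y x (phase f) ('D_x (phase f) y).
  by have d := is_derive_phase y x sf; apply: derivableP; case: d.
(* By [touch], the phase minus [S] is largest at t = 0 on the line x + t x, so the derivatives of
   both along [x] agree there. *)
have := @is_derive_le0_at_max R (fun t => phase f (x + t *: x) - S (x + t *: x))
  (fun t => 'D_x (phase f) (x + t *: x) - 'D_x S (x + t *: x)) 1
  (2^-1 * 'D_x ('D_x ('D_x f)) x - 'D_x ('D_x S) x) ltr01.
case.
- move=> t _; apply: is_deriveB.
    by apply: (@is_derive_line _ _ (phase f)); exact: dP.
  apply: (@is_derive_line _ _ S); exact: derivableP (smooth_derivable sS).
- apply: is_deriveB.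
    apply: (@is_derive_line _ _ ('D_x (phase f))); rewrite scale0r addr0.
    exact: is_derive2_phase.
  apply: (@is_derive_line _ _ ('D_x S)); rewrite scale0r addr0.
  exact: derivableP (smooth_derivable (smooth_derive x sS)).
- move=> t _; rewrite scale0r addr0; apply: cross.
  apply: le_trans (touch _) _; rewrite le_eqVlt; apply/orP; left; apply/eqP.
  by rewrite /S -sumrB; apply: eq_bigr => i _; rewrite mulrBr.
rewrite scale0r addr0 => /eqP; rewrite subr_eq0 => /eqP -> _.
rewrite dS mulr_sumr; apply: eq_bigr => i _.
by have [_ ->] := is_derive2_phase x (v i) sf; rewrite [RHS]mulrCA [2 * _]mulrA divff ?mul1r.
Qed.

(** * Radial perturbations of the phase *)

Lemma is_derive_dist2 x y v :
  is_derive x v (fun z => inner (z - y) (z - y)) (2 * inner (x - y) v).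
Proof.
have -> : (fun z : E => inner (z - y) (z - y)) =
    \sum_(k < m) (fun z : E => (z 0 k - y 0 k) * (z 0 k - y 0 k)).
  by apply/funext => z; rewrite fct_sumE; apply: eq_bigr => k _; rewrite !mxE.
have dk k : is_derive x v (fun z : E => (z 0 k - y 0 k) * (z 0 k - y 0 k))
    (2 * ((x - y) 0 k * v 0 k)).
  have d1 : is_derive x v (fun z : E => z 0 k - y 0 k) (v 0 k - 0).
    by apply: is_deriveB; exact: is_derive_coord.
  have d2 := is_deriveM d1 d1; apply: (is_derive_eq d2).
  by rewrite !mxE -![_ *: _]/(_ * _); ring.
by rewrite mulr_sumr; exact: is_derive_sum.
Qed.

Lemma is_derive_innerl x v w : is_derive x v (fun z : E => inner z w) (inner v w).
Proof.
have -> : (fun z : E => inner z w) = \sum_(k < m) (w 0 k \*: (fun z : E => z 0 k)).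
  by apply/funext => z; rewrite fct_sumE; apply: eq_bigr => k _; rewrite mulrC.
have -> : inner v w = \sum_(k < m) w 0 k *: v 0 k.
  by apply: eq_bigr => k _; rewrite mulrC.
by apply: is_derive_sum => k; apply: is_deriveZ; exact: is_derive_coord.
Qed.

(** The first and second derivative tests along x + t v for phi plus a radial function centred at
    [y]. The maximum is taken over a shell because [g] may be differentiable only near [q], as a
    logarithmic barrier is. *)
Lemma phase_radial_max2 f x y v (g g1 : R -> R) (g2 e : R)
    (q := inner (x - y) (x - y)) :
  smooth f -> 0 < e ->
  (forall s : R, `|s - q| < e -> is_derive s 1 g (g1 s)) ->
  is_derive q 1 g1 g2 ->
  (forall z, `|inner (z - y) (z - y) - q| < e ->
    phase f z + g (inner (z - y) (z - y)) <= phase f x + g q) ->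
  'D_v (phase f) x = - (2 * g1 q * inner (x - y) v) /\
  'D_v ('D_v (phase f)) x <=
    - (4 * g2 * inner (x - y) v ^+ 2 + 2 * g1 q * inner v v).
Proof.
move=> sf e0 dg dg1 fmax.
have [d d0 dP] := continuous_shift2 v 0 (@continuous_dist2 y x) e0.
have near_q (t : R) : `|t| < d -> `|inner (x + t *: v - y) (x + t *: v - y) - q| < e.
  by move=> /ltW td; have := dP t 0 td; rewrite normr0 scaler0 addr0; apply; exact: ltW.
have dP1 z : is_derive z v (phase f) ('D_v (phase f) z).
  by have h := is_derive_phase z v sf; apply: derivableP; case: h.
pose Q (t : R) := inner (x + t *: v - y) (x + t *: v - y).
have dQ (t : R) : is_derive t 1 Q (2 * inner (x + t *: v - y) v).
  by apply: (@is_derive_line _ _ (fun z => inner (z - y) (z - y)));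
    exact: is_derive_dist2.
have Q0 : Q 0 = q by rewrite /Q scale0r addr0.
have dm : is_derive (0 : R) 1 (fun t : R => 2 * inner (x + t *: v - y) v)
    (2 * inner v v).
  apply: is_deriveZ.
  have := @is_derive_line R E (fun z => inner (z - y) v) x v 0 (inner v v).
  apply; rewrite scale0r addr0.
  have -> : (fun z : E => inner (z - y) v) = (fun z => inner z v) + cst (- inner y v).
    by apply/funext => z; rewrite /= innerDl -scaleN1r innerZl mulN1r.
  rewrite -[X in is_derive _ _ _ X]addr0.
  by apply: is_deriveD; exact: is_derive_innerl.
have := @is_derive_le0_at_max R (fun t => phase f (x + t *: v) + g (Q t))
  (fun t => 'D_v (phase f) (x + t *: v) + g1 (Q t) * (2 * inner (x + t *: v - y) v))
  d ('D_v ('D_v (phase f)) x +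
     (g1 q * (2 * inner v v) + (2 * inner (x - y) v) * ((2 * inner (x - y) v) * g2))) d0.
case.
- move=> t td; apply: is_deriveD.
    by apply: (@is_derive_line _ _ (phase f)); exact: dP1.
  have dgt := dg _ (near_q t td).
  exact: is_derive1_comp dgt (dQ t).
- apply: is_deriveD.
    apply: (@is_derive_line _ _ ('D_v (phase f))); rewrite scale0r addr0.
    by have h := is_derive2_phase x v sf; apply: derivableP; case: h.
  rewrite -Q0 in dg1.
  have d1 := is_derive1_comp dg1 (dQ 0); have d2 := is_deriveM d1 dm.
  apply: (is_derive_eq d2).
  by rewrite -![_ *: _]/(_ * _) /= Q0 scale0r addr0 [g2 * _]mulrC.
- move=> t td; rewrite Q0 scale0r addr0; exact/fmax/near_q.
rewrite Q0 scale0r addr0 => E1 E2; split.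
  by apply/eqP; rewrite -addr_eq0 -E1; apply/eqP; ring.
rewrite -subr_le0 opprK (le_trans _ E2)// le_eqVlt; apply/orP; left; apply/eqP; ring.
Qed.

End SmoothFunctions.

(** * Hermitian matrices *)

Section HermitianMatrices.
Context {R : realType} {n : nat}.
Local Notation C := R[i].
Implicit Types (G P : 'M[C]_n) (w : 'rV[C]_n).
Local Open Scope sesquilinear_scope.
Local Open Scope complex_scope.

Definition qform G w : C := (w *m G *m w^t*) 0 0.

Lemma unitary_row_neq0 P i : P \is unitarymx -> row i P != 0.
Proof.
move=> /unitarymxP PP; apply/eqP => P0.
have := row_mul i P (P^t*); rewrite PP P0 mul0mx.
by move=> /matrixP/(_ 0 i)/eqP; rewrite !mxE eqxx oner_eq0.
Qed.

Lemma hermitian_diagonalization G : G^t* = G -> exists P (d : 'rV[R]_n),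
  P \is unitarymx /\ P *m G *m P^t* = diag_mx (map_mx (real_complex R) d).
Proof.
move=> GH; have herm : G \is hermsymmx by apply/is_hermitianmxP; rewrite expr0 scale1r.
have /orthomx_spectralP := hermitian_normalmx herm.
set P := spectralmx G; set s := spectral_diag G => GE.
have PU : P \is unitarymx by exact: spectral_unitarymx.
have sreal := hermitian_spectral_diag_real herm.
exists P, (map_mx (@complex.Re R) s); split => //.
have PP : P *m P^t* = 1%:M by exact/unitarymxP.
rewrite [X in _ *m X *m _]GE invmx_unitary// !mulmxA PP mul1mx.
rewrite -mulmxA PP mulmx1; congr diag_mx.
apply/rowP => i; rewrite !mxE RRe_real//.
by have /mxOverP/(_ 0 i) := sreal.
Qed.

Lemma qform_row G P (S := P *m G *m P^t*) i : S i i = qform G (row i P).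
Proof.
rewrite /S /qform mxE [RHS]mxE; apply: eq_bigr => k _.
by rewrite !mxE; congr (_ * _); apply: eq_bigr => l _; rewrite !mxE.
Qed.

Lemma unitary_det_diag G P (d : 'rV[R]_n) : P \is unitarymx ->
  P *m G *m P^t* = diag_mx (map_mx (real_complex R) d) ->
  \det G = (\prod_i d 0 i)%:C.
Proof.
move=> /unitarymxP PP PE.
have : \det (P *m G *m P^t*) = (\prod_i d 0 i)%:C.
  rewrite PE det_diag rmorph_prod.
  by apply: eq_bigr => i _; rewrite mxE.
by rewrite !det_mulmx mulrAC -det_mulmx PP det1 mul1r.
Qed.

Lemma qformZ G w (r : R) : qform G (r%:C *: w) = (r * r)%:C * qform G w.
Proof.
rewrite /qform linearZ map_mxZ -!scalemxAl -scalemxAr scalerA [LHS]mxE.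
by rewrite rmorphM /= [X in _ * X * _]conjc_real.
Qed.

Lemma ReD (z w : C) : complex.Re (z + w) = complex.Re z + complex.Re w.
Proof. by case: z w => [? ?] [? ?]. Qed.

Lemma Re_sum (I : Type) (r : seq I) (F : I -> C) :
  complex.Re (\sum_(i <- r) F i) = \sum_(i <- r) complex.Re (F i).
Proof. exact: (big_morph _ ReD). Qed.

Lemma Re_scale (r : R) (z : C) : complex.Re (r%:C * z) = r * complex.Re z.
Proof. by case: z => x y /=; rewrite mul0r subr0. Qed.

(** After diagonalization each eigenvalue satisfies d <= exp (d - 1), and these inequalities are
    multiplied. *)
Lemma det_expR_trace G : G^t* = G -> (forall w, w != 0 -> 0 < qform G w) ->
  exists e : R, [/\ 0 < e, \det G = e%:C & e <= expR (complex.Re (\tr G) - n%:R)].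
Proof.
move=> GH Gpos; have [P [d [PU PE]]] := hermitian_diagonalization GH.
have PtP : P^t* *m P = 1%:M by apply: mulmx1C; exact/unitarymxP.
have GE : G = P^t* *m diag_mx (map_mx (real_complex R) d) *m P.
  by rewrite -PE !mulmxA PtP mul1mx -mulmxA PtP mulmx1.
have d0 i : 0 < d 0 i.
  rewrite -ltcR; have := qform_row G P i.
  by rewrite PE !mxE eqxx mulr1n => ->; apply: Gpos; exact: unitary_row_neq0.
have PP : P *m P^t* = 1%:M by exact/unitarymxP.
exists (\prod_i d 0 i); split; first exact: prodr_gt0.
  rewrite GE -mulmxA !det_mulmx mulrCA -det_mulmx PtP det1 mulr1 det_diag.
  by rewrite rmorph_prod; apply: eq_bigr => i _; rewrite mxE.
have -> : complex.Re (\tr G) - n%:R = \sum_i (d 0 i - 1).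
  rewrite GE mxtrace_mulC mulmxA PP mul1mx mxtrace_diag.
  have -> : \sum_i (map_mx (real_complex R) d) 0 i = (\sum_i d 0 i)%:C.
    by rewrite rmorph_sum; apply: eq_bigr => i _; rewrite mxE.
  by rewrite /= big_split /= sumrN sumr_const card_ord.
rewrite expR_sum; apply: ler_prod => i _; rewrite ltW//=.
by have := expR_ge1Dx (d 0 i - 1); rewrite addrC subrK.
Qed.

(* With [S] sending [G0] to the identity, [S G S^*] is nonnegative and has
   determinant [det G / det G0]. *)
Lemma ln_det_le_tangent G0 P (d : 'rV[R]_n) G :
  P \is unitarymx -> P *m G0 *m P^t* = diag_mx (map_mx (real_complex R) d) ->
  (forall i, 0 < d 0 i) -> G^t* = G ->
  (forall w, w != 0 -> 0 < qform G w) ->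
  ln (complex.Re (\det G)) - ln (complex.Re (\det G0)) <=
  \sum_i (d 0 i)^-1 * (complex.Re (qform G (row i P)) - complex.Re (qform G0 (row i P))).
Proof.
move=> PU PE d0 GH Gpos.
have PP : P *m P^t* = 1%:M by exact/unitarymxP.
(* Scaling the eigenvectors of [G0] by the inverse square roots of the eigenvalues makes [S] carry
   [G0] to the identity. *)
have [s ss] : exists s : 'rV[R]_n, forall i, s 0 i * s 0 i = (d 0 i)^-1.
  exists (\row_i (Num.sqrt (d 0 i))^-1) => i.
  by rewrite mxE -expr2 exprVn sqr_sqrtr// ltW.
pose D := diag_mx (map_mx (real_complex R) s).
have Dt : D^t* = D.
  rewrite /D tr_diag_mx map_diag_mx; congr diag_mx; apply/rowP => i.
  by rewrite !mxE; exact: conjc_real.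
have [S SE] : exists S, S = D *m P by eexists.
have St : S^t* = P^t* *m D by rewrite SE trmx_mul map_mxM Dt.
have N0 : S *m G0 *m S^t* = 1%:M.
  rewrite St SE !mulmxA -(mulmxA D) -(mulmxA D) PE /D !mulmx_diag.
  apply/matrixP => i j; rewrite !mxE; congr (_ *+ _).
  have -> : (s 0 i)%:C * (d 0 i)%:C * (s 0 i)%:C = (s 0 i * s 0 i * d 0 i)%:C.
    by rewrite !rmorphM /= mulrAC.
  by rewrite ss mulVf// gt_eqF.
have Sunit : S \in unitmx.
  by have [] := mulmx1_unit (etrans (mulmxA _ _ _) N0).
pose N := S *m G *m S^t*.
have NH : N^t* = N.
  by rewrite /N trmx_mul map_mxM trmxCK trmx_mul map_mxM GH mulmxA.
have qN w : qform N w = qform G (w *m S).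
  by rewrite /qform /N !mulmxA trmx_mul map_mxM !mulmxA.
have Npos w : w != 0 -> 0 < qform N w.
  move=> w0; rewrite qN; apply: Gpos; apply: contra w0 => /eqP wS.
  by rewrite -(mulmxK Sunit w) wS mul0mx.
have [e [e0 detN etr]] := det_expR_trace NH Npos.
have k1 : \det S * \det (S^t*) * \det G0 = 1.
  by rewrite mulrAC -!det_mulmx N0 det1.
have k2 : \det S * \det (S^t*) * \det G = e%:C.
  by rewrite -detN /N !det_mulmx mulrAC.
have detG0 := unitary_det_diag PU PE.
have detG : \det G = (e * \prod_i d 0 i)%:C.
  by rewrite rmorphM /= -k2 -detG0 mulrAC k1 mul1r.
have p0 : 0 < \prod_i d 0 i by exact: prodr_gt0.
rewrite detG detG0 /= lnM ?posrE// addrK.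
(* The left-hand side is now [ln e], bounded by the trace inequality for [N]; the trace minus [n] is
   exactly the right-hand side. *)
apply: le_trans (_ : complex.Re (\tr N) - n%:R <= _).
  by rewrite -[leRHS]expRK ler_ln ?posrE ?expR_gt0.
rewrite le_eqVlt; apply/orP; left; apply/eqP.
have -> : \tr N = \sum_i ((d 0 i)^-1)%:C * qform G (row i P).
  apply: eq_bigr => i _; rewrite qform_row -ss.
  have -> : row i S = (s 0 i)%:C *: row i P.
    by rewrite SE row_mul row_diag_mx -scalemxAl -rowE mxE.
  exact: qformZ.
have qG0 i : qform G0 (row i P) = (d 0 i)%:C.
  by rewrite -qform_row PE !mxE eqxx.
have -> : n%:R = \sum_(i < n) (d 0 i)^-1 * complex.Re (qform G0 (row i P)).
  rewrite -[X in X%:R]card_ord -sumr_const; apply: eq_bigr => i _.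
  by rewrite qG0 /= mulVf// gt_eqF.
rewrite Re_sum -sumrB; apply: eq_bigr => i _.
by rewrite mulrBr; congr (_ - _); exact: Re_scale.
Qed.

Lemma real_eigenvalues_diag G P (d : 'rV[R]_n) : P \is unitarymx ->
  P *m G *m P^t* = diag_mx (map_mx (real_complex R) d) ->
  real_eigenvalues G = range (fun i => d 0 i).
Proof.
move=> PU PE; have PP : P *m P^t* = 1%:M by exact/unitarymxP.
have PtP := mulmx1C PP.
apply/seteqP; split => [r /eigenvalueP[v vG v0]|_ [i _ <-]] /=.
  have [w wE] : exists w, w = v *m P^t* by eexists.
  have vE : v = w *m P by rewrite wE -mulmxA PtP mulmx1.
  have wD : w *m diag_mx (map_mx (real_complex R) d) = r%:C *: w.
    by rewrite -PE !mulmxA -vE vG -scalemxAl wE.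
  have [i wi] : exists i, w 0 i != 0.
    apply/existsP; apply: contra_neqT v0; rewrite negb_exists => /forallP w0.
    rewrite vE; have -> : w = 0; last by rewrite mul0mx.
    by apply/rowP => i; have := w0 i; rewrite negbK [RHS]mxE => /eqP.
  exists i => //; move/matrixP/(_ 0 i) : wD; rewrite mul_mx_diag !mxE mulrC.
  by move=> /(mulIf wi) [].
apply/eigenvalueP; exists (row i P); last exact: unitary_row_neq0.
have PG : P *m G = diag_mx (map_mx (real_complex R) d) *m P.
  by rewrite -PE -mulmxA PtP mulmx1.
by rewrite -row_mul PG row_mul row_diag_mx -scalemxAl -rowE mxE.
Qed.

(** The eigenvalue set is the finite range of [d], bounded by the sum of the absolute values, so its
    [sup] and [inf] are genuine bounds. *)
Lemma diag_le_mu_max G P (d : 'rV[R]_n) i : P \is unitarymx ->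
  P *m G *m P^t* = diag_mx (map_mx (real_complex R) d) ->
  mu_min G <= d 0 i <= mu_max G.
Proof.
move=> PU PE; rewrite /mu_min /mu_max (real_eigenvalues_diag PU PE).
have bnd j : `|d 0 j| <= \sum_k `|d 0 k|.
  by rewrite (bigD1 j)//= lerDl sumr_ge0.
apply/andP; split; [apply: ge_inf | apply: ub_le_sup]; try by exists i.
  by exists (- \sum_k `|d 0 k|) => _ [j _ <-]; have := bnd j; rewrite ler_norml => /andP[].
by exists (\sum_k `|d 0 k|) => _ [j _ <-]; have := bnd j; rewrite ler_norml => /andP[].
Qed.

End HermitianMatrices.

(** [X] is the geometric mean, so some [d j] is at most [X] and some is at least [X]; comparability
    carries this over to every [d i]. *)
Lemma prod_comparable_bounds (R : realType) (n : nat) (d : 'I_n -> R) (L X : R) :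
  (forall i, 0 < d i) -> 0 < X -> \prod_i d i = X ^+ n ->
  (forall i j, d i <= L * d j) -> forall i, d i <= L * X /\ X <= L * d i.
Proof.
move=> d0 X0 dX dL i.
have XE : X ^+ n = \prod_(j < n) X by rewrite prodr_const card_ord.
have L0 : 0 < L by rewrite -(pmulr_lgt0 _ (d0 i)) (lt_le_trans (d0 i)).
split.
  have [j dj] : exists j, d j <= X.
    apply/not_existsP => h; suff : X ^+ n < \prod_i d i by rewrite dX ltxx.
    rewrite XE; apply: ltr_prod; first by apply/hasP; exists i; rewrite ?mem_index_enum.
    by move=> j _; rewrite ltW//= ltNge; apply/negP/h.
  by rewrite (le_trans (dL i j))// ler_pM2l.
have [j dj] : exists j, X <= d j.
  apply/not_existsP => h; suff : \prod_i d i < X ^+ n by rewrite dX ltxx.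
  rewrite XE; apply: ltr_prod; first by apply/hasP; exists i; rewrite ?mem_index_enum.
  by move=> j _; rewrite ltW//= ltNge; apply/negP/h.
by rewrite (le_trans dj).
Qed.

(** * The phase is constant *)

Section Rigidity.
Context {R : realType} {m p : nat}.
Local Notation E := ('rV[R]_m).
Variables (u : E -> R) (k a b N : R).
Hypotheses (su : smooth u) (k0 : 0 < k) (a0 : 0 < a) (b0 : 0 < b) (N0 : 0 <= N).
Local Notation phi := (phase u).
(** All that the maximum principle uses about the equation. In the application the [v i] are the
    unitary eigenvectors of the complex Hessian and their multiples by i, the [c i] are inverse
    eigenvalues over 4, k = 1/n, and the last clause is the concavity of ln det. *)
Hypothesis frame : forall x, exists (c : 'I_p -> R) (v : 'I_p -> E),
  [/\ forall i, a <= c i * expR (k * phi x) <= b,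
      forall w, \sum_i inner w (v i) ^+ 2 = inner w w,
      \sum_i inner (v i) (v i) = N &
      forall y, phi y - phi x <= \sum_i c i *
        ('D_(v i) ('D_(v i) u) y - 'D_(v i) ('D_(v i) u) x)].

(** The maximum principle for L. The derivative of phi along [x] is known from the first-order
    condition and from the linearized equation; the second-order conditions, summed with the weights
    [c i], compare the two. [A] weighs the squares of [inner (x - y) (v i)], and [B] the squared
    lengths of the [v i]. *)
Lemma phase_radial_max x y (g g1 : R -> R) (g2 e : R)
    (q := inner (x - y) (x - y)) : 0 < e ->
  (forall s : R, `|s - q| < e -> is_derive s 1 g (g1 s)) ->
  is_derive q 1 g1 g2 ->
  (forall z, `|inner (z - y) (z - y) - q| < e ->
    phi z + g (inner (z - y) (z - y)) <= phi x + g q) ->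
  exists A B : R, [/\ a * q <= A * expR (k * phi x) <= b * q,
    B * expR (k * phi x) <= b * N &
    4 * g2 * A + 2 * g1 q * B <= g1 q * inner (x - y) x].
Proof.
move=> e0 dg dg1 hmax.
have [c [v [cab vpars vN touch]]] := frame x.
have X0 := expR_gt0 (k * phi x); set X := expR _ in cab X0 *.
exists (\sum_i c i * inner (x - y) (v i) ^+ 2), (\sum_i c i * inner (v i) (v i)).
split.
- rewrite /q -vpars mulr_suml !mulr_sumr; apply/andP; split; apply: ler_sum => i _;
  by rewrite mulrAC ler_wpM2r ?sqr_ge0//; case/andP: (cab i).
- rewrite -vN mulr_suml mulr_sumr; apply: ler_sum => i _.
  by rewrite mulrAC ler_wpM2r ?inner_ge0//; case/andP: (cab i).
have rad w := @phase_radial_max2 R m u x y w g g1 g2 e su e0 dg dg1 hmax.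
have [D1 _] := rad x.
have := phase_linearized su touch.
rewrite D1 => D2.
have D3 : \sum_i c i * 'D_(v i) ('D_(v i) phi) x <=
   - (4 * g2 * (\sum_i c i * inner (x - y) (v i) ^+ 2) +
     2 * g1 q * (\sum_i c i * inner (v i) (v i))).
  rewrite !mulr_sumr -big_split /= -sumrN; apply: ler_sum => i _.
  have [_ Di] := rad (v i).
  have ci : 0 <= c i.
    case/andP: (cab i) => aci _.
    by rewrite -(pmulr_lge0 _ X0) (le_trans (ltW a0)).
  apply: le_trans (ler_wpM2l ci Di) _.
  by rewrite le_eqVlt; apply/orP; left; apply/eqP; rewrite /q; ring.
move: D2 D3; rewrite -/q; lra.
Qed.

Lemma phase_le_barrier x (r : R) : inner x x < r ->
  exists2 z, expR (k * phi x) * (r - inner x x) <= expR (k * phi z) * (r - inner z z)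
    & inner z z * (expR (k * phi z) * (r - inner z z)) <= b * (4 + 2 * N) * r.
Proof.
(* The exponential of k phi + ln (r - |z|^2): it is continuous on the closed ball and zero on its
   boundary, while [f x] is positive, so its maximum point [z] is interior. *)
move=> xr; pose f z := expR (k * phi z) * (r - inner z z).
have cf : continuous f.
  have cn : continuous (fun y : E => inner y y).
    by move=> y; have := @continuous_dist2 R m 0 y; under eq_fun do rewrite subr0.
  have cb y : {for y, continuous (fun y : E => r - inner y y)}.
    exact: (continuousB (@cst_continuous _ _ r y) (cn y)).
  have ck y : {for y, continuous (fun y : E => k * phi y)}.
    have -> : (fun y : E => k * phi y) = k \*: phi by [].
    by apply: continuousZl_tmp; exact: phase_continuous.
  have cX y : {for y, continuous (fun y : E => expR (k * phi y))}.
    by apply: (@continuous_comp _ _ _ (fun y => k * phi y) expR y (ck y));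
      exact: continuous_expR.
  move=> y; have := continuousM (cX y) (cb y); exact.
have r0 : 0 <= r by rewrite (le_trans (inner_ge0 x))// ltW.
have [z zr zmax] := max_closed_ball 0 r0 cf.
rewrite subr0 in zr.
have fx0 : 0 < f x by rewrite mulr_gt0 ?expR_gt0// subr_gt0.
have fz : f x <= f z by apply: zmax; rewrite subr0 ltW.
have s0 : 0 < r - inner z z.
  by move: (lt_le_trans fx0 fz); rewrite pmulr_rgt0// expR_gt0.
exists z; first exact: fz.
have [s sE] : exists s, s = r - inner z z by eexists.
rewrite -sE in s0 *.
have kV0 : 0 < k^-1 by rewrite invr_gt0.
(* Taking logarithms and dividing by [k] turns maximality of [f] into that of phi + k^-1 ln (r -
   |z|^2). *)
have lin (a1 a2 b1 b2 : R) : k * a1 + b1 <= k * a2 + b2 ->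
    a1 + k^-1 * b1 <= a2 + k^-1 * b2.
  move=> L; rewrite -(ler_pM2l k0) !mulrDr !mulrA divff ?gt_eqF//.
  by rewrite !mul1r.
have dr (t : R) : is_derive t 1 (fun t : R => r - t) (0 - 1).
  by apply: is_deriveB; exact: is_derive_cst.
have dg (t : R) : `|t - inner z z| < s ->
    is_derive t 1 (k^-1 \*: (@ln R \o (fun t : R => r - t))) (- (k^-1 / (r - t))).
  move=> ts; have rt : 0 < r - t.
    by move: ts; rewrite sE ltr_norml; lra.
  apply: is_derive_eq; first by apply: is_deriveZ; apply: is_derive1_comp;
    exact: is_derive1_ln.
  by rewrite -[_ *: _]/(_ * _) sub0r mulrN1 mulrN.
have dg1 : is_derive (inner z z) 1 (fun t : R => - (k^-1 / (r - t))) (- (k^-1 / s ^+ 2)).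
  have d1 : is_derive (inner z z) 1 (fun t : R => (r - t)^-1) (- s ^- 2 * (0 - 1)).
    by rewrite sE in s0 *; apply: is_deriveV; rewrite gt_eqF.
  have -> : (fun t : R => - (k^-1 / (r - t))) = - (k^-1 \*: (fun t : R => (r - t)^-1)).
    by [].
  by apply: is_derive_eq; rewrite -[_ *: _]/(_ * _) sub0r mulrN1 opprK.
have := @phase_radial_max z 0 (k^-1 \*: (@ln R \o (fun t : R => r - t)))
  (fun t : R => - (k^-1 / (r - t))) (- (k^-1 / s ^+ 2)) s s0.
rewrite subr0 => /(_ dg dg1).
case.
  move=> y; rewrite subr0 => ys.
  have y0 : 0 < r - inner y y by move: ys; rewrite sE ltr_norml; lra.
  have fy : f y <= f z.
    by apply: zmax; rewrite subr0; lra.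
  have fy0 : 0 < f y by rewrite mulr_gt0 ?expR_gt0.
  have : ln (f y) <= ln (f z).
    by rewrite ler_ln ?posrE // (lt_le_trans fy0).
  rewrite /f !lnM ?posrE ?expR_gt0 -?sE// sE !expRK => L.
  exact: lin.
move=> A [B [/andP[A1 A2] B1]]; rewrite -sE.
have X0 := expR_gt0 (k * phi z); set X := expR _ in A1 A2 B1 X0 fz *.
move: (inner z z) sE (inner_ge0 z) A1 A2 => q sE q0 A1 A2 AB.
have {}AB : s * q <= 4 * A + 2 * s * B.
  have ks : 0 < k^-1 / s ^+ 2 by rewrite divr_gt0// exprn_gt0.
  rewrite -(ler_pM2l ks) -lerN2; apply: le_trans (le_trans _ AB) _;
    rewrite le_eqVlt; apply/orP; left; apply/eqP; field;
    by rewrite !lt0r_neq0.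
(* Multiplying by [X] allows [A * X] and [B * X] to be replaced by their bounds b q and b N; both s
   and q are at most r = s + q. *)
have P1 := ler_wpM2r (ltW X0) AB.
have P2 : 2 * s * (B * X) <= 2 * s * (b * N) by rewrite ler_wpM2l// mulr_ge0// ltW.
have P3 : 0 <= b * s by rewrite mulr_ge0// ltW.
have P4 : 0 <= b * N * q by rewrite !mulr_ge0// ltW.
have -> : r = s + q by rewrite sE subrK.
have -> : q * (X * s) = s * q * X by ring.
by apply: (le_trans P1); rewrite mulrDl -(mulrA 4); nra.
Qed.

(** Instead of a limit in r, a maximum over one fixed ball is shown to be global: a larger value at
    [y] contradicts the barrier bound for a single large r. *)
Lemma phase_max : exists x, forall y, phi y <= phi x.
Proof.
pose C := b * (4 + 2 * N); have C0 : 0 < C by rewrite mulr_gt0// ltr_wpDr// mulr_ge0.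
(* Beyond squared radius [R0] the barrier bound C r / |z|^2 is below exp (k phi 0) r, hence below
   [B * r], since 0 lies in the ball. *)
pose R0 := C / expR (k * phi 0).
have R00 : 0 < R0 by rewrite divr_gt0// expR_gt0.
have [x xR] := max_closed_ball 0 (ltW R00) (phase_continuous su).
move=> xmax0; have xmax y : inner y y <= R0 -> phi y <= phi x.
  by have := xmax0 y; rewrite subr0.
exists x => y; rewrite leNgt; apply/negP => xy.
have mono v w : (expR (k * phi v) <= expR (k * phi w)) = (phi v <= phi w).
  by rewrite ler_expR ler_pM2l.
pose A := expR (k * phi y); pose B := expR (k * phi x).
have AB : B < A by rewrite ltNge mono -ltNge.
have B0 : 0 < B by exact: expR_gt0.
(* Chosen so large that A (r - |y|^2) > B r. *)
pose r := A * inner y y / (A - B) + 1.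
have AB0 : 0 < A - B by rewrite subr_gt0.
have rE : (A - B) * r = A * inner y y + (A - B).
  by rewrite /r; field; rewrite gt_eqF.
have yr : inner y y < r.
  rewrite -(ltr_pM2l AB0) rE.
  have : 0 <= B * inner y y by rewrite mulr_ge0 ?inner_ge0// ltW.
  lra.
have [z yz zr] := phase_le_barrier yr.
have r0 : 0 < r by rewrite (le_lt_trans _ yr)// inner_ge0.
suff : expR (k * phi z) * (r - inner z z) <= B * r.
  by move=> /(le_trans yz); rewrite -/A; move: rE AB0; lra.
(* Inside the fixed ball, phi z <= phi x suffices; outside it, the barrier bound is divided by |z|^2
   > [R0]. *)
have [zR|zR] := leP (inner z z) R0.
  have zx : expR (k * phi z) <= B by rewrite mono xmax.
  apply: le_trans (_ : expR (k * phi z) * r <= _); last by rewrite ler_wpM2r// ltW.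
  by rewrite ler_wpM2l ?expR_ge0// gerBl inner_ge0.
have z0 : 0 < inner z z by rewrite (lt_trans R00).
rewrite -(ler_pM2l z0) (le_trans zr)// -/C mulrA ler_wpM2r ?(ltW r0)//.
have -> : C = R0 * expR (k * phi 0) by rewrite divfK// gt_eqF// expR_gt0.
have x0 : expR (k * phi 0) <= B.
  by rewrite mono xmax// innerE mul0mx mxE ltW.
by apply: ler_pM => //; rewrite ?expR_ge0 ?(ltW R00)// ltW.
Qed.

(** The strong maximum principle, with Hopf's exponential perturbation centred at the point [y]
    where phi is assumed smaller. *)
Lemma phase_constant x x' : phi x = phi x'.
Proof.
have cphi : continuous phi by exact: phase_continuous.
have [xm xmax] := phase_max.
suff max_eq y : phi y = phi xm by rewrite !max_eq.
apply/eqP; rewrite eq_le xmax /= leNgt; apply/negP => {x x'} ym.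
pose M := phi xm; pose d := (M - phi y) / 2.
have d0 : 0 < d by rewrite divr_gt0// subr_gt0.
have [r0 r00 rP] : exists2 r : R, 0 < r &
    forall x : E, inner (x - y) (x - y) <= r -> phi x <= M - d.
  apply: euclidean_ball_nbhs.
  have /cvgrPdist_lt/(_ d d0) := cphi y.
  by apply: filterS => x; rewrite ltr_norml /d; lra.
pose X := expR (k * M).
have X0 : 0 < X := expR_gt0 _.
(* [T] will bound the terms that do not carry [al], and [al] is chosen so that the lower bound 4 a
   r0 al of the remaining one equals T + 1. *)
pose T := 2 * (b * N) + X * (inner y y / 4).
have T0 : 0 <= T.
  by rewrite addr_ge0 ?mulr_ge0 ?invr_ge0 ?inner_ge0// ltW.
pose al := (T + 1) / (4 * a * r0).
have ar0 : 0 < 4 * a * r0 by rewrite !mulr_gt0.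
have al0 : 0 < al by rewrite divr_gt0// ltr_wpDl.
have alE : al * (4 * a * r0) = T + 1 by rewrite divfK// gt_eqF.
pose h (s : R) := expR (- al * s).
pose q x := inner (x - y) (x - y).
have h1 x : h (q x) <= 1.
  by rewrite -expR0 ler_expR mulNr oppr_le0 mulr_ge0 ?inner_ge0// ltW.
pose w x := phi x + d * h (q x).
have dh0 (s : R) : is_derive s 1 h (- al * h s).
  have d1 : is_derive s 1 (- al \*: id : R -> R) (- al *: 1) by exact: is_deriveZ.
  have d2 := is_derive1_comp (is_derive_expR (- al * s)) d1.
  by apply: (is_derive_eq d2); rewrite [- al *: 1]mulr1 mulrC.
have cw : continuous w.
  move=> x; apply: (continuousD (cphi x)).
  have ch : continuous h.
    by move=> s; apply/differentiable_continuous/derivable1_diffP; case: (dh0 s).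
  have chq : {for x, continuous (h \o q)}.
    by apply: (continuous_comp (@continuous_dist2 R m y x)); exact: ch.
  have -> : (fun x => d * h (q x)) = d \*: (h \o q) by [].
  exact: continuousZl_tmp.
have [x xq xmaxw] := max_closed_ball y (inner_ge0 (xm - y)) cw.
have wx : M + d * h (q xm) <= w x by apply: xmaxw.
(* Farther from [y] than [xm], phi is at most [M] and the exponential is smaller than at [xm], so
   the maximum over the ball is global. *)
have wglob z : w z <= w x.
  have [zq|zq] := leP (q z) (q xm); first exact: xmaxw.
  apply: le_trans wx; rewrite lerD ?xmax// ler_wpM2l ?(ltW d0)//.
  by rewrite ler_expR !mulNr lerN2 ler_wpM2l ?(ltW al0)// ltW.
(* Near [y] the perturbation, at most [d], cannot lift phi above [M], whereas [w xm] exceeds [M]. *)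
have qx : r0 < q x.
  rewrite ltNge; apply/negP => /rP xM.
  have : w x <= M - d + d * 1 by rewrite lerD// ler_wpM2l ?(ltW d0).
  have : 0 < d * h (q xm) by rewrite mulr_gt0// expR_gt0.
  move: wx; lra.
have dh (s : R) : is_derive s 1 (d \*: h) (- al * (d * h s)).
  have d1 := @is_deriveZ _ _ _ _ d _ _ _ (dh0 s); apply: (is_derive_eq d1).
  by rewrite -[_ *: _]/(_ * _); ring.
have dh1 (s : R) : is_derive s 1 (fun s => - al * (d * h s)) (al ^+ 2 * (d * h s)).
  have -> : (fun s : R => - al * (d * h s)) = (- al \*: (d \*: h)) by [].
  have d1 := @is_deriveZ _ _ _ _ (- al) _ _ _ (dh s); apply: (is_derive_eq d1).
  by rewrite -[_ *: _]/(_ * _); ring.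
have := @phase_radial_max x y (d \*: h) (fun s => - al * (d * h s))
  (al ^+ 2 * (d * h (q x))) 1 ltr01 (fun s _ => dh s) (dh1 _) (fun z _ => wglob z).
move=> [A [B [/andP[A1 A2] B1 AB]]].
have {}AB : 4 * al * A + inner (x - y) x <= 2 * B.
  have H0 : 0 < al * (d * h (q x)).
    exact: mulr_gt0 al0 (mulr_gt0 d0 (expR_gt0 _)).
  rewrite -(ler_pM2l H0); move: AB; rewrite -/(q x) => AB.
  by rewrite -subr_ge0; rewrite -subr_ge0 in AB; apply: le_trans AB _;
    rewrite le_eqVlt; apply/orP; left; apply/eqP; ring.
(* Completing the square in z = x - y bounds the drift term independently of [x]. *)
have xyx : - (inner y y / 4) <= inner (x - y) x.
  have quad z : - (inner y y / 4) <= inner z z + inner z y.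
    have := inner_ge0 (z + 2^-1 *: y).
    by rewrite innerDl !innerDr !innerZl !innerZr (innerC y z); lra.
  by have := quad (x - y); rewrite -innerDr subrK.
have Xx : expR (k * phi x) <= X by rewrite ler_expR ler_pM2l.
have Xx0 := expR_gt0 (k * phi x).
move: (expR _) Xx Xx0 A1 A2 B1 => Z ZX Z0 A1 A2 B1.
have L1 : 4 * al * (A * Z) <= 2 * (B * Z) + inner y y / 4 * Z.
  have := ler_wpM2r (ltW Z0) AB.
  have := ler_wpM2r (ltW Z0) xyx.
  lra.
have L2 : inner y y / 4 * Z <= X * (inner y y / 4).
  by rewrite mulrC ler_wpM2r// divr_ge0 ?inner_ge0.
have L3 : al * (4 * a * r0) <= 4 * al * (A * Z).
  have -> : al * (4 * a * r0) = 4 * al * (a * r0) by ring.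
  apply: ler_wpM2l; first by rewrite mulr_ge0// ltW.
  by apply: le_trans A1; apply: ler_wpM2l; exact: ltW.
by move: L1 L2 L3; rewrite alE /T; lra.
Qed.

End Rigidity.

(** * Solutions of constant phase *)

Section ConstantPhase.
Context {R : realType} {m : nat}.
Local Notation E := ('rV[R]_m).
(** Such a [G] is constant on open rays, and being differentiable at the origin it keeps its value
    there. The mean value theorem gives an interior t > 0, by which t ['D_x G (t x)] = 0 can be
    divided. *)
Lemma euler_eq0_constant (G : E -> R) x : smooth G -> (forall y, euler G y = 0) ->
  G x = G 0.
Proof.
move=> sG G0.
have dG (t : R) : is_derive t 1 (fun t => G (0 + t *: x)) ('D_x G (0 + t *: x)).
  apply: (@is_derive_line _ _ G); exact: derivableP (smooth_derivable sG).
have cG : {within `[0, 1], continuous (fun t : R => G (0 + t *: x))}.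
  by apply: derivable_within_continuous => t _; case: (dG t).
have [t] := MVT ltr01 (fun t _ => dG t) cG.
rewrite in_itv /= => /andP[t0 _].
rewrite scale1r scale0r !add0r subr0 mulr1 => GE.
have : t * 'D_x G (t *: x) = 0.
  by rewrite (deriveE_smooth _ _ sG) -innerZl; exact: G0.
move=> /eqP; rewrite mulf_eq0 gt_eqF//= => /eqP D0.
by move: GE; rewrite D0 => /eqP; rewrite subr_eq0 => /eqP.
Qed.

Variable u : E -> R.
Hypotheses (su : smooth u) (phase_cst : forall x y, phase u x = phase u y).

Lemma derive_homogeneous1 v x : euler ('D_v u) x = 'D_v u x.
Proof.
have [_ D] := is_derive_phase x v su.
have P : phase u = cst (phase u 0) by apply/funext => y; exact: phase_cst.
move: D; rewrite P derive_cst => /esym/eqP.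
by rewrite mulf_eq0 invr_eq0 pnatr_eq0 /= subr_eq0 => /eqP.
Qed.

(** Differentiating the degree 1 homogeneity of ['D_v u] along [w], the commutator term cancels and
    leaves homogeneity of degree 0. *)
Lemma derive2_constant v w x : 'D_w ('D_v u) x = 'D_w ('D_v u) 0.
Proof.
have sv := smooth_derive v su; have sw := smooth_derive w sv.
have eul0 y : euler ('D_w ('D_v u)) y = 0.
  have [_ D] := is_derive_euler y w sv.
  have EU : euler ('D_v u) = 'D_v u by apply/funext => z; exact: derive_homogeneous1.
  by move: D; rewrite EU => /esym/eqP; rewrite -subr_eq0 addrK => /eqP.
exact: (euler_eq0_constant x sw eul0).
Qed.

Lemma constant_phase_quadratic : quadratic u.
Proof.
pose H := hessian u 0.
(* By definition of the phase, u = euler u / 2 - phase; each partial derivative in [euler u] is in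
   turn its own Euler derivative, whose coefficients are the constant second derivatives. *)
have uE x : u x = 2^-1 * (\sum_k \sum_l H l k * (x 0 k * x 0 l)) - phase u 0.
  rewrite (phase_cst 0 x) /phase /euler.
  have -> : inner x (gradient u x) = \sum_k \sum_l H l k * (x 0 k * x 0 l).
    apply: eq_bigr => k _; rewrite mxE.
    have -> : partial k u x = euler (partial k u) x.
      by rewrite [RHS](derive_homogeneous1 (delta_mx 0 k) x).
    rewrite mulr_sumr; apply: eq_bigr => l _; rewrite !mxE.
    have -> : partial l (partial k u) x = partial l (partial k u) 0.
      exact: (derive2_constant (delta_mx 0 k) (delta_mx 0 l) x).
    by rewrite mulrA mulrC.
  ring.
pose p : mpoly m R := \sum_k \sum_l (2^-1 * H l k) *: mpolyX R (mnm_add (mnm1 k) (mnm1 l))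
  - mpolyC m (phase u 0).
exists p; split.
  apply: leq_trans (msizeD_le _ _) _; rewrite geq_max; apply/andP; split.
    apply: leq_trans (msize_sum _ _ _) _; apply/bigmax_leqP => k _.
    apply: leq_trans (msize_sum _ _ _) _; apply/bigmax_leqP => l _.
    apply: leq_trans (msizeZ_le _ _) _.
    by rewrite msizeX mdegD !mdeg1.
  by rewrite msizeN msizeC; case: (_ != 0).
move=> x; rewrite uE mevalB mevalC; congr (_ - _).
rewrite mulr_sumr (big_morph _ (mevalD _) (meval0 _)); apply: eq_bigr => k _.
rewrite mulr_sumr (big_morph _ (mevalD _) (meval0 _)); apply: eq_bigr => l _.
by rewrite mevalZ mpolyXD mevalM !mevalXU !mulrA.
Qed.

End ConstantPhase.

(** * The complex Hessian *)

Section ComplexHessian.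
Context {R : realType} {n : nat}.
Local Notation C := R[i].
Local Notation E := ('rV[R]_(n + n)).
Implicit Types (u : E -> R) (x v : E) (z w : 'rV[C]_n).
Local Open Scope sesquilinear_scope.
Local Open Scope complex_scope.

Definition realify w : E :=
  row_mx (map_mx (@complex.Re R) w) (map_mx (@complex.Im R) w).

Lemma realifyl w a : realify w 0 (lshift n a) = complex.Re (w 0 a).
Proof. by rewrite row_mxEl mxE. Qed.

Lemma realifyr w a : realify w 0 (rshift n a) = complex.Im (w 0 a).
Proof. by rewrite row_mxEr mxE. Qed.

Lemma realifyil w a : realify ('i *: w) 0 (lshift n a) = - complex.Im (w 0 a).
Proof. by rewrite realifyl mxE; case: (w 0 a) => p q /=; ring. Qed.

Lemma realifyir w a : realify ('i *: w) 0 (rshift n a) = complex.Re (w 0 a).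
Proof. by rewrite realifyr mxE; case: (w 0 a) => p q /=; ring. Qed.

Lemma realify_surj v : exists w, realify w = v.
Proof.
exists (\row_a (v 0 (lshift n a) +i* v 0 (rshift n a))).
apply/rowP => k; case: (split_ordP k) => a ->.
  by rewrite realifyl mxE.
by rewrite realifyr mxE.
Qed.

Lemma realify_eq0 w : realify w = 0 -> w = 0.
Proof.
move=> w0; apply/rowP => a; rewrite mxE; apply/eqP; rewrite eq_complex /=.
by rewrite -realifyl -realifyr w0 !mxE eqxx.
Qed.

Lemma ImD (z w : C) : complex.Im (z + w) = complex.Im z + complex.Im w.
Proof. by case: z w => [? ?] [? ?]. Qed.

Lemma Im_sum (I : Type) (r : seq I) (F : I -> C) :
  complex.Im (\sum_(i <- r) F i) = \sum_(i <- r) complex.Im (F i).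
Proof. exact: (big_morph _ ImD). Qed.

Lemma hermitian_dot_realify z w :
  (z *m w^t*) 0 0 = inner (realify z) (realify w) +i*
                    inner (realify z) (realify ('i *: w)).
Proof.
apply/eqP; rewrite eq_complex /inner !big_split_ord /=; apply/andP; split; apply/eqP.
  rewrite mxE Re_sum -big_split; apply: eq_bigr => a _ /=.
  rewrite !realifyl !realifyr !mxE.
  by case: (z 0 a) (w 0 a) => [p q] [r s] /=; ring.
rewrite mxE Im_sum -big_split; apply: eq_bigr => a _ /=.
rewrite realifyil realifyir realifyl realifyr !mxE.
by case: (z 0 a) (w 0 a) => [p q] [r s] /=; ring.
Qed.

(** The squared modulus of each Hermitian coordinate is the sum of two squared real ones, so the
    rows of [P] and their multiples by i satisfy Parseval on R^(2n). *)
Lemma unitary_parseval (P : 'M[C]_n) v : P \is unitarymx ->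
  \sum_i (inner v (realify (row i P)) ^+ 2 +
          inner v (realify ('i *: row i P)) ^+ 2) = inner v v.
Proof.
move=> /unitarymxP PP; have [z <-] := realify_surj v.
have -> : inner (realify z) (realify z) = complex.Re ((z *m z^t*) 0 0).
  by rewrite hermitian_dot_realify.
have [Y YE] : exists Y, Y = z *m P^t* by eexists.
have <- : Y *m Y^t* = z *m z^t*.
  rewrite YE trmx_mul map_mxM trmxCK mulmxA -(mulmxA z).
  by rewrite (mulmx1C PP) mulmx1.
rewrite mxE Re_sum; apply: eq_bigr => i _.
have Yi : Y 0 i = (z *m (row i P)^t*) 0 0.
  by rewrite YE !mxE; apply: eq_bigr => a _; rewrite !mxE.
have -> : (Y^t*) i 0 = (Y 0 i)^* by rewrite !mxE.
by rewrite Yi hermitian_dot_realify /=; ring.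
Qed.

Lemma complex_hessianE u x a b : smooth u ->
  complex_hessian u x a b =
    4^-1%:C * ((hessian u x (lshift n a) (lshift n b) +
                hessian u x (rshift n a) (rshift n b)) +i*
               (hessian u x (lshift n a) (rshift n b) -
                hessian u x (rshift n a) (lshift n b))).
Proof.
move=> su.
have half : (2^-1 : C) = (2^-1 : R)%:C by rewrite fmorphV rmorph_nat.
have partial0 k y : partial k (fun _ : E => 0 : R) y = 0 by exact: derive_cst.
have dzbarE : dzbar b (fun y => (u y)%:C) =
    fun y => (2^-1 * partial (lshift n b) u y) +i* (2^-1 * partial (rshift n b) u y).
  apply/funext => y; rewrite /dzbar /partialC half /= !partial0.
  move: (partial (lshift n b) _ y) (partial (rshift n b) _ y) => p q.
  apply/eqP; rewrite eq_complex /=; apply/andP; split; apply/eqP; ring.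
have dhalf (k l : 'I_(n + n)) : partial k (fun y => 2^-1 * partial l u y) x =
    2^-1 * partial k (partial l u) x.
  have sl := smooth_partial l su.
  have [_ D] := @is_deriveZ _ _ _ _ (2^-1) _ _ _ (is_derive_partial k x sl).
  exact: D.
have hE j k : hessian u x j k = partial j (partial k u) x by rewrite mxE.
rewrite mxE dzbarE /dz /partialC !dhalf half !hE.
move: (partial (lshift n a) (partial (lshift n b) u) x)
  (partial (lshift n a) (partial (rshift n b) u) x)
  (partial (rshift n a) (partial (lshift n b) u) x)
  (partial (rshift n a) (partial (rshift n b) u) x) => p q r s.
apply/eqP; rewrite eq_complex /=; apply/andP; split; apply/eqP; by field.
Qed.

Lemma hessian_sym u x j k : smooth u -> hessian u x j k = hessian u x k j.
Proof. by move=> su; rewrite !mxE; exact: smooth_derive_comm. Qed.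

Lemma complex_hessian_herm u x : smooth u ->
  (complex_hessian u x)^t* = complex_hessian u x.
Proof.
move=> su; apply/matrixP => a b; rewrite !mxE -/(complex_hessian u x b a).
have := complex_hessianE x b a su; rewrite mxE => ->.
have := complex_hessianE x a b su; rewrite mxE => ->.
rewrite (hessian_sym x (lshift n b) (lshift n a) su) (hessian_sym x (rshift n b) (rshift n a) su)
  (hessian_sym x (lshift n b) (rshift n a) su) (hessian_sym x (rshift n b) (lshift n a) su).
apply/eqP; rewrite eq_complex /=; apply/andP; split; apply/eqP; ring.
Qed.

(** Expresses the Hermitian form through real second derivatives along w and iw, which transfers
    convexity and yields the real frame. The imaginary part vanishes because the complex Hessian is
    Hermitian. *)
Lemma qform_complex_hessian u x w : smooth u ->
  qform (complex_hessian u x) w =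
    (4^-1 * (inner (realify w *m hessian u x) (realify w) +
             inner (realify ('i *: w) *m hessian u x) (realify ('i *: w))))%:C.
Proof.
move=> su; set H := hessian u x; set G := complex_hessian u x.
apply/eqP; rewrite eq_complex; apply/andP; split; apply/eqP; last first.
  have GH : (qform G w)^* = qform G w.
    have -> : (qform G w)^* = ((w *m G *m w^t*)^t*) 0 0.
      by rewrite [RHS]mxE [X in _ = Num.conj X]mxE.
    by rewrite trmx_mul map_mxM trmxCK trmx_mul map_mxM complex_hessian_herm// mulmxA.
  move: GH => /(congr1 (@complex.Im R)); case: (qform G w) => p q /=; lra.
have innE v : inner (v *m H) v = \sum_k \sum_j v 0 j * H j k * v 0 k.
  by apply: eq_bigr => k _; rewrite mxE mulr_suml.
have ordE (F : 'I_(n + n) -> 'I_(n + n) -> R) : \sum_k \sum_j F j k =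
   \sum_b \sum_a (F (lshift n a) (lshift n b) + F (rshift n a) (lshift n b) +
     (F (lshift n a) (rshift n b) + F (rshift n a) (rshift n b))).
  rewrite big_split_ord /= -big_split; apply: eq_bigr => b _ /=.
  by rewrite !big_split_ord /= -!big_split.
rewrite !innE !ordE /= -big_split mulr_sumr /qform mxE Re_sum.
apply: eq_bigr => b _; rewrite mxE mulr_suml Re_sum -big_split mulr_sumr /=.
apply: eq_bigr => a _.
rewrite complex_hessianE// -/H !realifyil !realifyir !realifyl !realifyr.
have -> : (w^t*) b 0 = (w 0 b)^* by rewrite !mxE.
move: (H _ _) (H _ _) (H _ _) (H _ _) (w 0 a) (w 0 b) => h1 h2 h3 h4 [p q] [r s] /=.
ring.
Qed.

Lemma complex_hessian_posdef u x w : smooth u -> strictly_convex u -> w != 0 ->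
  0 < qform (complex_hessian u x) w.
Proof.
move=> su /(_ x)[_ cu] w0; rewrite qform_complex_hessian// ltcR.
have pos z : z != 0 -> 0 < inner (realify z *m hessian u x) (realify z).
  by move=> z0; apply: cu; apply: contra z0 => /eqP/realify_eq0 ->.
by rewrite mulr_gt0 ?invr_gt0// addr_gt0 ?pos// scaler_eq0 negb_or w0 andbT
  eq_complex /= oner_eq0 andbF.
Qed.

(** Supplies the hypothesis [frame] of the maximum principle by diagonalizing the complex Hessian at
    [x]. *)
Lemma complex_hessian_frame u (L : R) x : (0 < n)%N -> 0 < L -> smooth u ->
  strictly_convex u ->
  (forall y, ln (complex.Re (\det (complex_hessian u y))) = phase u y) ->
  mu_max (complex_hessian u x) <= L * mu_min (complex_hessian u x) ->
  exists (c : 'I_(n + n) -> R) (v : 'I_(n + n) -> E),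
  [/\ forall i, (4 * L)^-1 <= c i * expR (n%:R^-1 * phase u x) <= L / 4,
      forall w : E, \sum_i inner w (v i) ^+ 2 = inner w w,
      \sum_i inner (v i) (v i) = (n + n)%:R &
      forall y, phase u y - phase u x <= \sum_i c i *
        ('D_(v i) ('D_(v i) u) y - 'D_(v i) ('D_(v i) u) x)].
Proof.
move=> n0 L0 su cu ueq comp.
have herm y := complex_hessian_herm y su.
have pos y w : w != 0 -> 0 < qform (complex_hessian u y) w.
  exact: complex_hessian_posdef.
have [P [d [PU PE]]] := hermitian_diagonalization (herm x).
have qd i : qform (complex_hessian u x) (row i P) = (d 0 i)%:C.
  by rewrite -qform_row PE !mxE eqxx.
have d0 i : 0 < d 0 i by rewrite -ltcR -qd; apply: pos; exact: unitary_row_neq0.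
have detE := unitary_det_diag PU PE.
have dL i j : d 0 i <= L * d 0 j.
  have /andP[_ di] := diag_le_mu_max i PU PE.
  have /andP[dj _] := diag_le_mu_max j PU PE.
  by apply: le_trans di (le_trans comp _); rewrite ler_pM2l.
set X := expR _.
have X0 : 0 < X by exact: expR_gt0.
(* The determinant is exp (phase), so [X] is the geometric mean of the eigenvalues. *)
have XE : \prod_i d 0 i = X ^+ n.
  rewrite /X -expRM_natl mulrA divff ?mul1r ?pnatr_eq0 -?lt0n//.
  by rewrite -ueq detE lnK// posrE prodr_gt0.
have bnd := prod_comparable_bounds d0 X0 XE dL.
have sl a : fintype.split (lshift n a) = inl a :> 'I_n + 'I_n := unsplitK (inl a).
have sr a : fintype.split (rshift n a) = inr a :> 'I_n + 'I_n := unsplitK (inr a).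
(* The left half of the indices carries the eigenvectors, the right half their multiples by i, with
   equal weights. The 4 comes from the factor 1/4 in [qform_complex_hessian]. *)
pose c (k : 'I_(n + n)) := (4 * d 0 (match fintype.split k with inl a => a | inr a => a end))^-1.
pose v (k : 'I_(n + n)) := match fintype.split k with
  inl a => realify (row a P) | inr a => realify ('i *: row a P) end.
have pars (w : E) : \sum_i inner w (v i) ^+ 2 = inner w w.
  rewrite big_split_ord /= -big_split /= -(unitary_parseval w PU).
  by apply: eq_bigr => a _; rewrite /v sl sr.
exists c, v; split => //.
- move=> k; rewrite /c; move: (match _ with inl a => a | inr a => a end) => a.
  have [b1 b2] := bnd a.
  rewrite [_ * X]mulrC; apply/andP; split.
    by rewrite ler_pdivlMr ?mulr_gt0// ler_pdivrMl ?mulr_gt0//; lra.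
  by rewrite ler_pdivrMr ?mulr_gt0//; lra.
- exact: parseval_trace.
move=> y; rewrite -!ueq.
have qE (z : E) i : complex.Re (qform (complex_hessian u z) (row i P)) =
    4^-1 * ('D_(realify (row i P)) ('D_(realify (row i P)) u) z +
            'D_(realify ('i *: row i P)) ('D_(realify ('i *: row i P)) u) z).
  by rewrite (qform_complex_hessian z (row i P) su) !(derive2_hessian z _ su).
have distr (e r s r' s' : R) : e^-1 * (4^-1 * (r + s) - 4^-1 * (r' + s')) =
    (4 * e)^-1 * (r - r') + (4 * e)^-1 * (s - s') by rewrite invfM; ring.
pose F (w z : E) : R := 'D_w ('D_w u) z.
have lhsE : \sum_i (d 0 i)^-1 * (complex.Re (qform (complex_hessian u y) (row i P)) -
      complex.Re (qform (complex_hessian u x) (row i P))) =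
    \sum_a ((4 * d 0 a)^-1 * (F (realify (row a P)) y - F (realify (row a P)) x) +
      (4 * d 0 a)^-1 * (F (realify ('i *: row a P)) y - F (realify ('i *: row a P)) x)).
  apply: eq_bigr => a _; apply: etrans (distr _ _ _ _ _).
  by apply: (congr2 (fun r s => (d 0 a)^-1 * (r - s))); exact: qE.
have rhsE : \sum_i c i * (F (v i) y - F (v i) x) =
    \sum_a ((4 * d 0 a)^-1 * (F (realify (row a P)) y - F (realify (row a P)) x) +
      (4 * d 0 a)^-1 * (F (realify ('i *: row a P)) y - F (realify ('i *: row a P)) x)).
  rewrite big_split_ord /= -big_split.
  apply: eq_bigr => a _.
  by rewrite /c /v sl sr.
apply: le_trans (ln_det_le_tangent PU PE d0 (herm y) (pos y)) _.
by rewrite lhsE -rhsE.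
Qed.

End ComplexHessian.

Local Close Scope classical_set_scope.
Unset Implicit Arguments.

(* The determinant below is that of a Hermitian matrix, hence it is real and
   equal to its real part. *)
Theorem theorem1p3 (R : realType) (n : nat) (hn : (1 <= n)%N)
    (u : 'rV[R]_(n + n) -> R)
    (u_smooth : smooth u)
    (u_convex : strictly_convex u)
    (u_eq : forall x : 'rV[R]_(n + n),
      ln (complex.Re (\det (complex_hessian u x)))
      = 2^-1 * inner x (gradient u x) - u x)
    (u_comparable : exists Lambda : R, 1 <= Lambda /\
      forall x : 'rV[R]_(n + n),
        mu_max (complex_hessian u x) <= Lambda * mu_min (complex_hessian u x)) :
  quadratic u.
Proof.
have [L [L1 comp]] := u_comparable.
have L0 : 0 < L by exact: lt_le_trans L1.
have ueq y : ln (complex.Re (\det (complex_hessian u y))) = phase u y by exact: u_eq.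
have frame x := complex_hessian_frame hn L0 u_smooth u_convex ueq (comp x).
apply: (constant_phase_quadratic u_smooth) => x y.
(* The constants are k = 1/n, a = 1/(4 L), b = L/4 and N = 2n; their signs remain to be checked. *)
apply: (phase_constant u_smooth _ _ _ _ frame).
- by rewrite invr_gt0 ltr0n.
- by rewrite invr_gt0 mulr_gt0.
- by rewrite divr_gt0.
- exact: ler0n.
Qed.
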